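(* For every integer $k\geq 2$, every $n$-vertex graph $G$ with odd girth at least $2k+1$ and minimum degree $\delta(G)>\frac{4n}{6k-1}$ is homomorphic to the Möbius ladder $M_{4k}$.
   Context: Graphs are finite and simple, without loops. The odd girth of a graph is the length of its shortest odd cycle; ''odd girth at least $2k+1$'' means that the graph contains no cycle of length $3,5,\ldots,2k-1$ (bipartite graphs are allowed). A graph $G$ is homomorphic to a graph $H$ if there is a map $\varphi:V(G)\to V(H)$ such that $\varphi(u)\varphi(v)\in E(H)$ whenever $uv\in E(G)$. For an even integer $r\geq 6$, the Möbius ladder $M_r$ is the graph obtained from a cycle $C_r$ of length $r$ by adding all diagonal chords, i.e. all edges joining two vertices at distance $\frac r2$ on the cycle. *)

(* Defs.v *)
From mathcomp Require Import all_boot.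

Set Implicit Arguments.
Unset Strict Implicit.
Unset Printing Implicit Defensive.

Record sgraph := SGraph {
  vertex :> finType;
  adj : rel vertex;
  adj_sym : symmetric adj;
  adj_irrefl : irreflexive adj }.

Definition degree (G : sgraph) (v : G) : nat := #|[set w | adj v w]|.

(* Every degree is smaller than #|G|, so the default value of the minimum only
   matters for the graph without vertices, where it is 0. *)
Definition min_degree (G : sgraph) : nat :=
  \big[minn/#|G|]_(v : G) degree v.

Definition graph_cycle (G : sgraph) (c : seq G) : Prop :=
  2 < size c /\ ucycle (@adj G) c.

Definition odd_girth_at_least (G : sgraph) (g : nat) : Prop :=
  forall c : seq G, graph_cycle c -> odd (size c) -> g <= size c.

Definition homomorphic (G H : sgraph) : Prop :=
  exists f : G -> H, forall u v : G, adj u v -> adj (f u) (f v).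

Definition walk_of_length (G : sgraph) (d : nat) (x y : G) : bool :=
  [exists p : d.-tuple G, path (@adj G) x p && (last x p == y)].

Definition at_distance (G : sgraph) (d : nat) (x y : G) : bool :=
  walk_of_length d x y && [forall d' : 'I_d, ~~ walk_of_length d' x y].

(* In the next two definitions the guard i != j is redundant as soon as
   r >= 2; it makes the construction total in r. *)
Definition cycle_adj (r : nat) : rel 'I_r :=
  fun i j => (i != j) && ((i.+1 %% r == j) || (j.+1 %% r == i)).

Lemma cycle_adj_sym (r : nat) : symmetric (@cycle_adj r).
Proof. by move=> i j; rewrite /cycle_adj eq_sym orbC. Qed.

Lemma cycle_adj_irrefl (r : nat) : irreflexive (@cycle_adj r).
Proof. by move=> i; rewrite /cycle_adj eqxx. Qed.

Definition cycle_graph (r : nat) : sgraph :=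
  SGraph (@cycle_adj_sym r) (@cycle_adj_irrefl r).

Lemma walk_of_length_sym (G : sgraph) (d : nat) :
  symmetric (@walk_of_length G d).
Proof.
suff imp x y : walk_of_length d x y -> @walk_of_length G d y x.
  by move=> x y; apply/idP/idP; apply: imp.
case/existsP=> p /andP[xp /eqP<-].
have sz : size (rev (belast x p)) == d by rewrite size_rev size_belast size_tuple.
apply/existsP; exists (Tuple sz) => /=; apply/andP; split.
  rewrite rev_path (@eq_path _ _ (@adj G)) // => u v; exact: adj_sym.
by case: (tval p) => [|a s] //=; rewrite rev_cons last_rcons.
Qed.

Lemma at_distance_sym (G : sgraph) (d : nat) : symmetric (@at_distance G d).
Proof.
move=> x y; rewrite /at_distance walk_of_length_sym; congr (_ && _).
by apply: eq_forallb => d'; rewrite walk_of_length_sym.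
Qed.

Definition mobius_adj (r : nat) : rel 'I_r :=
  fun i j => (i != j) &&
    (cycle_adj i j || at_distance (G := cycle_graph r) r./2 i j).

Lemma mobius_adj_sym (r : nat) : symmetric (@mobius_adj r).
Proof.
by move=> i j; rewrite /mobius_adj eq_sym cycle_adj_sym at_distance_sym.
Qed.

Lemma mobius_adj_irrefl (r : nat) : irreflexive (@mobius_adj r).
Proof. by move=> i; rewrite /mobius_adj eqxx. Qed.

Definition mobius_ladder (r : nat) : sgraph :=
  SGraph (@mobius_adj_sym r) (@mobius_adj_irrefl r).

(* Main.v *)
(* Joining two nonadjacent vertices with no even walk of length at most 2k-2
   between them keeps the odd girth, so one may assume that any two nonadjacent
   vertices are joined by a walk of length 2k-2.  The degree condition is used
   through one double count: if no vertex has more than m neighbours in a list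
   of s vertices, then 4s < m(6k-1).

   There is a vertex v such that the graph is bipartite off N(v).  For k = 2
   take v of minimum degree.  For k >= 3 every closed walk of length 2k+1 turns
   out to be dominating (an undominated vertex yields Moebius-ladder-like
   subgraphs whose rungs are forced by the double count), and then v can be any
   vertex of such a walk.

   Rank the two colour classes off N(v) by 0 and 1, rank N(v) by 2, and let the
   net length of a walk count its ascents minus its descents.  A shortest closed
   walk of length l < 2k|d| and net length d would violate the double count, so
   the weights 1 + 2k (ascent) and 1 - 2k (descent) admit a potential c, which
   changes by 2k-1, 2k or 2k+1 along every edge.  Since (2k-1)^2 = 1 modulo 4k,
   v |-> (2k-1) c(v) maps these differences to 1, 2k and -1. *)

Require Import Defs.
From mathcomp Require Import all_boot all_order all_algebra zify.
From Stdlib Require Import Classical.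

Set Implicit Arguments.
Unset Strict Implicit.
Unset Printing Implicit Defensive.

(** * Walks and double counting *)

(** One parity rule yields nearly all local constraints: two neighbours of a vertex are never joined
    by an odd walk shorter than 2k-1. On a closed walk of length 2k+1 it leaves a vertex at most two
    neighbours, two steps apart. The constant of the theorem is what this rule carries through the
    double count: three pieces with 6k-1 entries in total (two rails of a ladder and a detour, or a
    closed walk of length 2k+1 and two walks reaching it) allow up to six neighbours, and 4s <
    m(6k-1) just fails for s = 6k-1 and m = 4, so the vertices with five or six neighbours must be
    excluded or exploited. Entries are counted with multiplicity, so overlaps between pieces do no
    harm. The ranks alone give only (2k-1)|d| <= l for a closed walk, whereas the potential needs
    2k|d| <= l; the double count supplies the missing |d|. Inside the domination argument k = 3
    stands apart: a list of 4k-4 entries with at most two neighbours per vertex contradicts the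
    count only for k >= 4, and lists of nine chosen vertices replace it. *)

Section Walks.

Variables (V : finType) (e : rel V).
Hypothesis e_sym : symmetric e.

(** Walks live on a bare relation and may repeat vertices: they can be cut, spliced and rotated
    freely, and the relation can grow during saturation. *)
Fixpoint wlk d x y :=
  if d is d'.+1 then [exists z, e x z && wlk d' z y] else x == y.

Lemma wlk0 x : wlk 0 x x. Proof. exact: eqxx. Qed.

Lemma wlkS d x y z : e x y -> wlk d y z -> wlk d.+1 x z.
Proof. by move=> xy yz; apply/existsP; exists y; rewrite xy. Qed.

Lemma wlk1 x y : wlk 1 x y = e x y.
Proof.
apply/existsP/idP => [[z /andP[xz /eqP <-]] //|xy].
by exists y; rewrite xy /= eqxx.
Qed.

Lemma wlk_cat a b x y z : wlk a x y -> wlk b y z -> wlk (a + b) x z.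
Proof.
elim: a x => [|a IH] x /=; first by move/eqP->.
case/existsP=> t /andP[xt ty] yz; exact: wlkS xt (IH _ ty yz).
Qed.

Lemma wlk_sym d x y : wlk d x y -> wlk d y x.
Proof.
elim: d x y => [|d IH] x y /=; first by rewrite eq_sym.
case/existsP=> t /andP[xt ty].
have tx : wlk 1 t x by rewrite wlk1 e_sym.
by have := wlk_cat (IH _ _ ty) tx; rewrite addn1.
Qed.

Lemma wlk_fun (f : nat -> V) N i j :
  (forall m, m < N -> e (f m) (f m.+1)) -> i <= j -> j <= N ->
  wlk (j - i) (f i) (f j).
Proof.
move=> fN; elim: j => [|j IH]; first by rewrite leqn0 => /eqP-> _; apply: wlk0.
rewrite leq_eqVlt => /predU1P[-> _|ij jN]; first by rewrite subnn wlk0.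
have fj : wlk 1 (f j) (f j.+1) by rewrite wlk1 fN.
by have := wlk_cat (IH ij (ltnW jN)) fj; rewrite subSn // addn1.
Qed.

Lemma wlk_funP d x y : wlk d x y ->
  exists f : nat -> V, [/\ f 0 = x, f d = y & forall m, m < d -> e (f m) (f m.+1)].
Proof.
elim: d x => [|d IH] x /=; first by move/eqP->; exists (fun=> y).
case/existsP=> t /andP[xt /IH[f [f0 fd fP]]].
exists (fun i => if i is j.+1 then f j else x); split=> // -[|m] md /=.
  by rewrite f0.
exact: fP.
Qed.

Lemma wlk_pad m d x y z : e x z -> wlk d x y -> wlk (d + m.*2) x y.
Proof.
move=> xz xy; elim: m => [|m IH]; first by rewrite addn0.
rewrite doubleS !addnS; apply: (wlkS xz); apply: (wlkS _ IH).
by rewrite e_sym.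
Qed.

Definition no_short_odd k := forall d x, odd d -> wlk d x x -> 2 * k < d.

Definition dense k := forall v, 4 * #|V| < (6 * k - 1) * #|[set w | e v w]|.

Definition saturated k := forall x y, ~~ e x y -> wlk (2 * k - 2) x y.

Lemma sum_count (s : seq V) :
  \sum_(z : V) count (e z) s = \sum_(w <- s) #|[set z | e w z]|.
Proof.
elim: s => [|w s IH]; first by rewrite big_nil big1.
rewrite big_cons -IH /= big_split /=; congr (_ + _).
rewrite -sum1_card [RHS]big_mkcond /=; apply: eq_bigr => z _.
by rewrite inE e_sym; case: (e w z).
Qed.

(** Repetitions in [s] are allowed, since each entry contributes its own degree. The typical use is
    by contradiction: s = 6k-1 with m = 4, or s >= 3k with m = 2. *)
Lemma dense_count k m (s : seq V) : dense k -> s != [::] ->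
  (forall z, count (e z) s <= m) -> 4 * size s < m * (6 * k - 1).
Proof.
move=> dk s0 sm.
have V0 : 0 < #|V| by case: s s0 {sm} => // v s _; apply/card_gt0P; exists v.
have le : \sum_(w <- s) #|[set z | e w z]| <= #|V| * m.
  rewrite -sum_count -sum_nat_const leq_sum // => z _; exact: sm.
have lt : 4 * #|V| * size s < (6 * k - 1) * \sum_(w <- s) #|[set z | e w z]|.
  case: s s0 {sm le} => // v s _ /=; rewrite big_cons mulnDr mulnS.
  rewrite -addSn leq_add //; elim: s => [|w s IH]; first by rewrite muln0.
  rewrite big_cons mulnDr /= mulnS leq_add //; exact: ltnW.
rewrite -(ltn_pmul2l V0).
have := leq_mul (leqnn (6 * k - 1)) le; lia.
Qed.

End Walks.

(** * Reduction to saturated graphs *)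

Lemma path_map_iota (T : Type) (r : rel T) (f : nat -> T) a m :
  (forall i, a <= i < a + m -> r (f i) (f i.+1)) ->
  path r (f a) [seq f i | i <- iota a.+1 m].
Proof.
elim: m a => //= m IH a fP; rewrite fP; last by lia.
by apply: IH => i ai; apply: fP; lia.
Qed.

(** A repeated vertex cuts an odd closed walk into two shorter closed walks, one of them odd;
    without repetition the walk is a cycle. *)
Lemma girth_no_short_odd (G : sgraph) k :
  odd_girth_at_least G (2 * k + 1) -> no_short_odd (@adj G) k.
Proof.
move=> gG; elim/ltn_ind => d IH x od xx.
have [f [f0 fd fP]] := wlk_funP xx.
have [fi|] := boolP [forall i : 'I_d, forall j : 'I_d, (f i == f j) ==> (i == j)].
  have d3 : 2 < d.
    case: d od fd fP {IH xx fi} => [|[|[|d]]] //= _ f1 /(_ 0 isT).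
    by rewrite f1 f0 adj_irrefl.
  have sc : size [seq f i | i <- iota 0 d] = d by rewrite size_map size_iota.
  suff : 2 * k + 1 <= size [seq f i | i <- iota 0 d] by rewrite sc; lia.
  apply: gG; last by rewrite sc.
  split; first by rewrite sc.
  apply/andP; split; last first.
    rewrite map_inj_in_uniq ?iota_uniq // => i j; rewrite !mem_iota /= !add0n => id jd fij.
    have /forallP/(_ (Ordinal jd)) := forallP fi (Ordinal id).
    by rewrite /= fij eqxx /= => /eqP[].
  case: d fP fd d3 {IH od xx fi sc} => // d fP fd _.
  rewrite /=.
  have -> : rcons [seq f i | i <- iota 1 d] (f 0) = [seq f i | i <- iota 1 d.+1].
    by rewrite -(addn1 d) iotaD map_cat /= cats1 add1n f0 fd.
  by apply: path_map_iota => i /andP[_ id]; apply: fP.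
rewrite negb_forall => /existsP[i]; rewrite negb_forall => /existsP[j].
rewrite negb_imply => /andP[/eqP fij ij].
wlog lij : i j fij ij / i < j.
  have [lij|lji|eij] := ltngtP i j; last by rewrite (ord_inj eij) eqxx in ij.
    by move/(_ i j); apply.
  by move/(_ j i); apply; rewrite // eq_sym.
have jd := ltn_ord j.
have w1 : wlk (@adj G) (j - i) (f i) (f i).
  by rewrite {2}fij; apply: (wlk_fun fP); lia.
have w2 : wlk (@adj G) ((d - j) + (i - 0)) (f i) (f i).
  rewrite {1}fij; apply: (@wlk_cat _ _ _ _ _ (f d)); first by apply: (wlk_fun fP); lia.
  by rewrite fd -f0; apply: (wlk_fun fP); lia.
have [o1|o1] := boolP (odd (j - i)).
  have lt : j - i < d by lia.
  have := IH _ lt _ o1 w1; lia.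
have lt : (d - j) + (i - 0) < d by lia.
have o2 : odd ((d - j) + (i - 0)) by lia.
have := IH _ lt _ o2 w2; lia.
Qed.

Section Saturate.
Variables (V : finType) (k : nat).

Lemma dense_deg (e : rel V) : dense e k -> forall v, exists w, e v w.
Proof.
move=> /[swap] v /(_ v) dv; have : 0 < #|[set w | e v w]| by lia.
by case/card_gt0P => w; rewrite inE; exists w.
Qed.

Section AddEdge.
Variables (e : rel V) (u v : V).
Hypotheses (e_sym : symmetric e) (og : no_short_odd e k).
Hypothesis far : forall d, ~~ odd d -> d <= 2 * k - 2 -> ~~ wlk e d u v.

Definition add_edge x y := [|| e x y, (x == u) && (y == v) | (x == v) && (y == u)].

Lemma add_edge_sym : symmetric add_edge.
Proof. by move=> x y; rewrite /add_edge e_sym orbCA orbC -orbA andbC [(y == v) && _]andbC orbCA orbA orbC. Qed.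

(** Crossing the new edge exchanges the ends [u] and [v] and flips the parity. When the first step
    crosses it, one of the two alternatives holds with a trivial walk, because the other parity
    would contradict [far] or [og]. *)
Lemma add_edge_inv m b : m < 2 * k -> wlk add_edge m b u ->
  (exists m', [/\ m' <= m, odd m' = odd m & wlk e m' b u]) \/
  (exists m', [/\ m' < m, odd m' = ~~ odd m & wlk e m' b v]).
Proof.
elim: m b => [|m IH] b mk /=; first by move/eqP->; left; exists 0; split=> //; apply: wlk0.
case/existsP=> c /andP[bc /IH] {IH} []; first exact: ltnW.
- case=> m' [m'm om cu].
  case/or3P: bc => [bc|/andP[/eqP-> /eqP cv]|/andP[/eqP-> /eqP cu']].
  + by left; exists m'.+1; split=> //=; [rewrite om | apply: wlkS bc cu].
  + left; exists 0; split; rewrite ?wlk0 //=.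
    have [//|] := boolP (odd m); rewrite -om => em.
    have/negP[] := @far m' em ltac:(lia); rewrite wlk_sym // -cv //.
  + right; exists 0; split; rewrite ?wlk0 //=; rewrite cu' in cu.
    have [|//] := boolP (odd m); rewrite -om => om'.
    have := og om' cu; lia.
- case=> m' [m'm om cv].
  case/or3P: bc => [bc|/andP[/eqP-> /eqP cv']|/andP[/eqP-> /eqP cu]].
  + by right; exists m'.+1; split=> //=; [rewrite om | apply: wlkS bc cv].
  + left; exists 0; split; rewrite ?wlk0 //=; rewrite cv' in cv.
    have [//|em] := boolP (odd m); rewrite em in om.
    by have := og om cv; lia.
  + right; exists 0; split; rewrite ?wlk0 //=; rewrite cu in cv.
    have [em|//] := boolP (odd m); rewrite em in om.
    by have/negP[] := @far m' ltac:(by rewrite om) ltac:(lia).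
Qed.

(** Lets a closed walk through the new edge be rotated so that it starts at [u], where
    [add_edge_inv] applies. *)
Lemma add_edge_meets d x y : wlk add_edge d x y ->
  wlk e d x y \/ exists j, [/\ j <= d, wlk add_edge j x u & wlk add_edge (d - j) u y].
Proof.
elim: d x => [|d IH] x /=; first by left.
case/existsP=> c /andP[xc cy].
case: (IH _ cy) => [cy'|[j [jd cu uy]]]; last first.
  by right; exists j.+1; split=> //; apply: wlkS xc cu.
case/or3P: (xc) => [xc'|/andP[/eqP xu _]|/andP[_ /eqP cu]].
- by left; apply: (wlkS xc' cy').
- right; exists 0; rewrite subn0; split=> //; first by rewrite xu wlk0.
  by rewrite -xu; apply: wlkS xc cy.
- right; exists 1; rewrite subSS subn0; split=> //; first by rewrite wlk1 -cu.
  by rewrite -cu.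
Qed.

Lemma add_edge_no_short_odd : no_short_odd add_edge k.
Proof.
move=> d x od xx; rewrite ltnNge; apply/negP => dk.
case: (add_edge_meets xx) => [xx'|[j [jd xu ux]]]; first by have := og od xx'; lia.
have := wlk_cat ux xu; rewrite subnK // => uu.
case: (add_edge_inv _ uu) => [||[m' [m'd om w]]]; first by lia.
- by case=> m' [m'd om w]; rewrite od in om; have := og om w; lia.
- by have/negP := @far m' ltac:(by rewrite om od) ltac:(lia).
Qed.

End AddEdge.

(** A shorter even walk could be lengthened to 2k-2 by going back and forth along an edge, which
    exists by density. *)
Lemma not_saturated_far (e : rel V) : symmetric e -> dense e k -> ~~ [forall x, forall y, e x y || wlk e (2 * k - 2) x y] ->
  exists u v, ~~ e u v /\ forall d, ~~ odd d -> d <= 2 * k - 2 -> ~~ wlk e d u v.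
Proof.
move=> es de; rewrite negb_forall => /existsP[u]; rewrite negb_forall => /existsP[v].
rewrite negb_or => /andP[nuv nw]; exists u, v; split=> // d ed dk.
apply: contra nw => w; have [z uz] := dense_deg de u.
have -> : 2 * k - 2 = d + ((2 * k - 2 - d)./2).*2 by lia.
exact: wlk_pad es _ _ _ _ _ uz w.
Qed.

Lemma dense_mono (e e' : rel V) : subrel e e' -> dense e k -> dense e' k.
Proof.
move=> ee' de v; apply: leq_trans (de v) _; rewrite leq_mul2l; apply/orP; right.
by apply/subset_leq_card/subsetP => w; rewrite !inE; apply: ee'.
Qed.

(** Induction on the number of nonadjacent pairs. The property must pass to subrelations, as having
    a homomorphism to a fixed graph does. *)
Lemma saturation_ind (P : rel V -> Prop) :
  (forall e e', subrel e e' -> P e' -> P e) ->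
  (forall e, symmetric e -> no_short_odd e k -> dense e k -> saturated e k -> P e) ->
  forall e, symmetric e -> no_short_odd e k -> dense e k -> P e.
Proof.
move=> Pmono Psat e.
have [m] := ubnP #|[pred p : V * V | ~~ e p.1 p.2]|.
elim: m e => // m IH e em es og de.
have [/forallP sat|nsat] := boolP [forall x, forall y, e x y || wlk e (2 * k - 2) x y].
  apply: Psat => // x y nxy; have /forallP/(_ y) := sat x.
  by rewrite (negPf nxy).
have [u [v [nuv far]]] := not_saturated_far es de nsat.
have sub : subrel e (add_edge e u v) by move=> x y xy; rewrite /add_edge xy.
apply: (Pmono _ _ sub); apply: IH.
- rewrite -ltnS; apply: leq_ltn_trans em; apply: proper_card; apply/properP; split.
    by apply/subsetP=> -[x y]; rewrite !inE /=; apply: contra; apply: sub.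
  by exists (u, v); rewrite !inE /= ?nuv // /add_edge !eqxx orbT.
- exact: add_edge_sym.
- exact: add_edge_no_short_odd.
- exact: dense_mono de.
Qed.

End Saturate.

(** * Closed walks with large net length *)

Lemma third_index (P : pred nat) (s : seq nat) a b : uniq s -> 2 < count P s ->
  exists u : nat, [/\ u \in s, P u, u <> a & u <> b].
Proof.
move=> us c3; have [/hasP[u us' /and3P[]]|/hasPn nh] := boolP (has [pred u | [&& P u, u != a & u != b]] s).
  by move=> Pu /eqP ua /eqP ub; exists u.
have : size (filter P s) <= size [:: a; b].
  apply: uniq_leq_size; first exact: filter_uniq.
  move=> u; rewrite mem_filter => /andP[Pu /nh] /=; rewrite Pu /= negb_and !negbK !inE.
  by [].
by rewrite size_filter /=; lia.
Qed.

Section Winding.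
Import GRing.Theory.
Variables (V : finType) (e : rel V) (k : nat) (v0 : V) (col : V -> bool).
Hypotheses (k2 : 1 < k) (e_sym : symmetric e) (og : no_short_odd e k).
Hypothesis dns : dense e k.
Hypothesis col_proper : forall a b, ~~ e v0 a -> ~~ e v0 b -> e a b -> col a != col b.

Definition rank a : nat := if e v0 a then 2 else col a.
Definition sg a b : int := if rank a < rank b then 1%R else (-1)%R.

Lemma no_triangle a b c : e a b -> e b c -> e a c -> False.
Proof.
move=> ab bc ac.
have w : wlk e 3 a a by apply: (wlkS ab); apply: (wlkS bc); rewrite wlk1 e_sym.
by have := @og 3 _ isT w; lia.
Qed.

Lemma rank_neq a b : e a b -> rank a != rank b.
Proof.
move=> ab; rewrite /rank; case va: (e v0 a); case vb: (e v0 b).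
- by case: (no_triangle va ab vb).
- by case: (col b).
- by case: (col a).
- by have := col_proper (negbT va) (negbT vb) ab; case: (col a); case: (col b).
Qed.

Lemma sgN a b : e a b -> sg b a = (- sg a b)%R.
Proof. by move=> /rank_neq; rewrite /sg; case: ltngtP. Qed.

(* [d] is the number of ascents minus the number of descents. *)
Fixpoint nwlk l (d : int) x y : Prop :=
  if l is l'.+1 then exists2 z, e x z & nwlk l' (d - sg x z)%R z y
  else x = y /\ d = 0%R.

Lemma nwlk0 x : nwlk 0 0%R x x. Proof. by []. Qed.

Lemma nwlkS l d x y z : e x y -> nwlk l d y z -> nwlk l.+1 (sg x y + d)%R x z.
Proof. by move=> xy yz; exists y; rewrite // addrC addKr. Qed.

Lemma nwlk1 x y : e x y -> nwlk 1 (sg x y) x y.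
Proof. by move=> xy; rewrite -[sg x y]addr0; apply: nwlkS xy _; apply: nwlk0. Qed.

Lemma nwlk_cat l1 d1 l2 d2 x y z : nwlk l1 d1 x y -> nwlk l2 d2 y z ->
  nwlk (l1 + l2) (d1 + d2)%R x z.
Proof.
elim: l1 d1 x => [|l IH] d1 x /=; first by case=> -> ->; rewrite add0r.
case=> t xt ty yz; exists t => //.
by rewrite addrAC; apply: IH yz.
Qed.

Lemma nwlk_rev l d x y : nwlk l d x y -> nwlk l (- d)%R y x.
Proof.
elim: l d x y => [|l IH] d x y /=; first by case=> -> ->; rewrite oppr0.
case=> t xt /IH ty; have tx : nwlk 1 (sg t x) t x by apply: nwlk1; rewrite (e_sym t x).
have := nwlk_cat ty tx; rewrite addn1 (sgN xt) => w.
by congr nwlk : w; lia.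
Qed.

Lemma nwlk_wlk l d x y : nwlk l d x y -> wlk e l x y.
Proof.
elim: l d x => [|l IH] d x /=; first by case=> -> _; apply: eqxx.
by case=> t xt /IH ty; apply: wlkS xt ty.
Qed.

Lemma nwlk_odd l d x y : nwlk l d x y -> odd `|d|%N = odd l.
Proof.
elim: l d x => [|l IH] d x /=; first by case=> _ ->.
case=> t xt /IH <-; rewrite /sg; case: ifP => _; lia.
Qed.

Lemma nwlk_funP l d x y : nwlk l d x y ->
  exists f : nat -> V, [/\ f 0 = x, f l = y & forall m, m < l -> e (f m) (f m.+1)] /\
   d = (\sum_(0 <= i < l) sg (f i) (f i.+1))%R.
Proof.
elim: l d x => [|l IH] d x /=.
  by case=> -> ->; exists (fun=> y); rewrite big_geq.
case=> t xt /IH[f [[f0 fl fP] dE]].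
exists (fun i => if i is j.+1 then f j else x); split; first split=> // -[|m] ml /=.
- by rewrite f0.
- exact: fP.
by rewrite big_nat_recl //= f0 -dE addrC subrK.
Qed.

Lemma nwlk_fun (f : nat -> V) i j : (forall m, i <= m < j -> e (f m) (f m.+1)) -> i <= j ->
  nwlk (j - i) (\sum_(i <= m < j) sg (f m) (f m.+1))%R (f i) (f j).
Proof.
elim: j => [|j IH] fP; first by rewrite leqn0 => /eqP->; rewrite big_geq.
rewrite leq_eqVlt => /predU1P[->|ij]; first by rewrite subnn big_geq.
rewrite subSn // -addn1 big_nat_recr //=.
by apply: nwlk_cat (IH _ ij) (nwlk1 _) => [m mj|]; apply: fP; lia.
Qed.

Lemma rank_le2 a : rank a <= 2.
Proof. by rewrite /rank; case: ifP => // _; case: (col a). Qed.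

Lemma sg_rank a b : ~~ e v0 a -> ~~ e v0 b -> e a b -> sg a b = ((rank b)%:Z - (rank a)%:Z)%R.
Proof.
move=> va vb ab; have := rank_neq ab; rewrite /sg /rank (negPf va) (negPf vb).
by case: (col a); case: (col b).
Qed.

Lemma sum_sg_rank (f : nat -> V) i j :
  (forall m, i <= m <= j -> ~~ e v0 (f m)) -> (forall m, i <= m < j -> e (f m) (f m.+1)) -> i <= j ->
  (\sum_(i <= m < j) sg (f m) (f m.+1))%R = ((rank (f j))%:Z - (rank (f i))%:Z)%R.
Proof.
elim: j => [|j IH] nS fP; first by rewrite leqn0 => /eqP->; rewrite big_geq // subrr.
rewrite leq_eqVlt => /predU1P[->|ij]; first by rewrite big_geq // subrr.
rewrite big_nat_recr //= IH // => [|m mj|m mj].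
- rewrite sg_rank; [lia | apply: nS; lia | apply: nS; lia | apply: fP; lia].
- apply: nS; lia.
- apply: fP; lia.
Qed.

(** Cut at the first return to N(v0). Such an excursion descends, telescopes between ranks 0 and 1,
    and ascends, so its net length is at most 1; if it equals 1, the excursion is odd and closes up
    through [v0], hence has length at least 2k-1. *)
Lemma hub_return l d x y : e v0 x -> e v0 y -> nwlk l d x y -> ((2 * k%:Z - 1) * d <= l%:Z)%R.
Proof.
elim/ltn_ind: l d x => l IH d x vx vy w.
have [l0|lpos] := posnP l.
  by move: w; rewrite l0 /= => -[_ ->]; rewrite mulr0.
have [f [[f0 fl fP] dE]] := nwlk_funP w.
have ex : exists j, (0 < j <= l) && e v0 (f j) by exists l; rewrite lpos leqnn fl.
case: (ex_minnP ex) => j /andP[/andP[j0 jl] vj] jmin.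
have wj : nwlk (j - 0) (\sum_(0 <= m < j) sg (f m) (f m.+1))%R (f 0) (f j).
  by apply: nwlk_fun => // m mj; apply: fP; lia.
have wl : nwlk (l - j) (\sum_(j <= m < l) sg (f m) (f m.+1))%R (f j) (f l).
  by apply: nwlk_fun => // m mj; apply: fP; lia.
rewrite fl in wl; have lt : l - j < l by lia.
have h2 := IH _ lt _ _ vj vy wl.
have -> : d = ((\sum_(0 <= m < j) sg (f m) (f m.+1)) + (\sum_(j <= m < l) sg (f m) (f m.+1)))%R.
  by rewrite dE -big_cat_nat.
set a := (\sum_(0 <= m < j) _)%R in wj *; set b := (\sum_(j <= m < l) _)%R in h2 *.
have nS m : 0 < m < j -> ~~ e v0 (f m).
  by move=> mj; apply/negP => vm; have := jmin m; rewrite vm andbT => /(_ ltac:(lia)); lia.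
have a1 : (a <= 1)%R.
  have [j1|j1] := leqP j 1.
    have j1' : j = 1 by lia.
    have -> : a = sg (f 0) (f 1) by rewrite /a j1' big_nat1.
    by rewrite /sg; case: ifP.
  have aE : a = (sg (f 0) (f 1) + (\sum_(1 <= m < j.-1) sg (f m) (f m.+1)) + sg (f j.-1) (f j))%R.
    rewrite /a big_ltn //; case: (j) j1 => [|[|j']] //= _.
    by rewrite big_nat_recr //= addrA.
  rewrite aE sum_sg_rank => [|m mj|m mj|]; last by lia.
  - have s01 : sg (f 0) (f 1) = (-1)%R.
      by rewrite /sg {1}/rank f0 vx; case: ltngtP (rank_le2 (f 1)) => //; lia.
    have := rank_le2 (f j.-1); have n1 := nS j.-1 ltac:(lia).
    have : rank (f j.-1) <= 1 by rewrite /rank (negPf n1); case: (col _).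
    by rewrite s01 /sg; case: ifP; lia.
  - by apply: nS; lia.
  - by apply: fP; lia.
have a2 : (a = 1)%R -> 2 * k - 1 <= j.
  move=> ae; have oj : odd j by have := nwlk_odd wj; rewrite ae subn0 => <-.
  have cw : wlk e (1 + (j - 0) + 1) v0 v0.
    have w1 : wlk e 1 v0 (f 0) by rewrite wlk1 f0.
    have w2 : wlk e 1 (f j) v0 by rewrite wlk1 (e_sym (f j)).
    exact: wlk_cat (wlk_cat w1 (nwlk_wlk wj)) w2.
  by have := og _ cw => /(_ ltac:(lia)); lia.
have [ae|an] := eqVneq a 1%R.
  by have := a2 ae; rewrite ae; move: h2; lia.
have a0 : (a <= 0)%R by lia.
have : ((2 * k%:Z - 1) * a <= 0)%R by apply: Num.Theory.mulr_ge0_le0 => //; lia.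
by move: h2; lia.
Qed.

Lemma nwlk_rot l d x i (f : nat -> V) : f 0 = x -> f l = x -> (forall m, m < l -> e (f m) (f m.+1)) ->
  d = (\sum_(0 <= m < l) sg (f m) (f m.+1))%R -> i <= l -> nwlk l d (f i) (f i).
Proof.
move=> f0 fl fP dE il.
have w1 := @nwlk_fun f 0 i (fun m mi => fP m ltac:(lia)) isT.
have w2 := @nwlk_fun f i l (fun m mi => fP m ltac:(lia)) il.
rewrite fl -f0 in w2; have := nwlk_cat w2 w1; congr nwlk; first by lia.
by rewrite dE addrC -big_cat_nat.
Qed.

Lemma hub_closed_pos l d x : nwlk l d x x -> ((2 * k%:Z - 1) * d <= l%:Z)%R.
Proof.
move=> w; have [f [[f0 fl fP] dE]] := nwlk_funP w.
have [/existsP[i vi]|] := boolP [exists i : 'I_l.+1, e v0 (f i)].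
  by apply: (hub_return vi vi); apply: (nwlk_rot f0 fl fP dE); rewrite -ltnS.
rewrite negb_exists => /forallP nS.
have -> : d = 0%R.
  rewrite dE sum_sg_rank => // [|m ml]; first by rewrite f0 fl subrr.
  have ml' : m < l.+1 by lia.
  exact: (nS (Ordinal ml')).
by rewrite mulr0.
Qed.

Lemma hub_closed l d x : nwlk l d x x -> ((2 * k%:Z - 1) * `|d| <= l%:Z)%R.
Proof.
move=> w; have h1 := hub_closed_pos w; have h2 := hub_closed_pos (nwlk_rev w).
by have [d0|d0] := Num.Theory.ger0P d; [exact: h1 | exact: h2].
Qed.

(** * Neighbours of a vertex on a shortest closed walk violating the net length bound *)

Section MinimalWalk.
Variables (l : nat) (d : int) (F : nat -> V).
Hypothesis Fper : forall i, F (i + l) = F i.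
Hypothesis FP : forall i, e (F i) (F i.+1).
Let H i := (\sum_(0 <= m < i) sg (F m) (F m.+1))%R.
Hypotheses (HF : H l = d) (d0 : (0 < d)%R) (viol : (l%:Z < 2 * k%:Z * d)%R).
Hypothesis NV : forall l' d' x, l' < l -> nwlk l' d' x x -> (2 * k%:Z * `|d'| <= l'%:Z)%R.
Variable z : V.
Let P i := e z (F i).
(** The height at which [z] is reached through [F i]. Differences of [phi] are the net lengths of
    the closed walks from [z] along an arc of [F] and back. *)
Let phi i := (H i + sg (F i) z)%R.

Lemma H_per i : H (i + l) = (H i + d)%R.
Proof.
elim: i => [|i IH]; first by rewrite add0n HF /H big_geq // add0r.
rewrite addSn /H !big_nat_recr //= -/(H _) -/(H _) IH addrAC -addSn !Fper.
by [].
Qed.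

Lemma phi_per i : phi (i + l) = (phi i + d)%R.
Proof. by rewrite /phi H_per Fper addrAC. Qed.

Lemma P_per i : P (i + l) = P i.
Proof. by rewrite /P Fper. Qed.

Lemma P_next i : P i -> ~~ P i.+1.
Proof. by move=> Pi; apply/negP => Pj; apply: (no_triangle Pi (FP i) Pj). Qed.

Lemma arc i j : i <= j -> P i -> P j -> nwlk (j - i).+2 (phi j - phi i)%R z z.
Proof.
move=> ij Pi Pj.
have w1 : nwlk 1 (sg z (F i)) z (F i) by apply: nwlk1.
have w2 : nwlk 1 (sg (F j) z) (F j) z by apply: nwlk1; rewrite (e_sym (F j)).
have w := nwlk_cat (nwlk_cat w1 (@nwlk_fun F i j (fun m _ => FP m) ij)) w2.
congr nwlk : w; first by lia.
have HE : H j = (H i + \sum_(i <= m < j) sg (F m) (F m.+1))%R by rewrite /H -big_cat_nat.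
rewrite /phi HE; have := sgN Pi; lia.
Qed.

(** Two neighbours of [z] split [F] into two closed walks through [z]. For j > i + 2 both are
    shorter than [F], so both obey the bound [NV]; parity then sharpens 2k-2 to 2k-1 when the
    heights differ by one. *)
Lemma gap i j : i < j -> j + 4 <= i + l -> P i -> P j ->
  [\/ j = i + 2 /\ phi j = phi i, phi j = (phi i + 1)%R /\ 2 * k - 1 <= j - i |
      (phi i + 2 <= phi j)%R /\ 4 * k - 2 <= j - i].
Proof.
move=> ij jl Pi Pj.
have w1 := arc (ltnW ij) Pi Pj.
have il : j <= i + l by lia.
have Pil : P (i + l) by rewrite P_per.
have w2 := arc il Pj Pil; rewrite phi_per in w2.
have o1 := nwlk_odd w1.
have n1 := NV (ltac:(lia) : (j - i).+2 < l) w1.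
have ij1 : j != i.+1 by apply/eqP => ji; have := P_next Pi; rewrite -ji Pj.
set D := (phi j - phi i)%R in w1 o1 n1.
have [j2|j2] := eqVneq j (i + 2).
  apply: Or31; split=> //; have : (`|D| <= 1)%R.
    rewrite -(@Num.Theory.ler_pM2l _ (2 * k%:Z)%R); last by lia.
    by apply: Order.POrderTheory.le_trans n1 _; lia.
  by rewrite j2 in o1; move: o1; rewrite /D j2; lia.
have n2 := NV (ltac:(lia) : (i + l - j).+2 < l) w2.
(* Otherwise the return arc has net length at least [d] and fewer steps than [F], so it would
   violate [NV]. *)
have D1 : (1 <= D)%R.
  have [//|D0] := Order.TotalTheory.leP 1%R D.
  have : (2 * k%:Z * d <= 2 * k%:Z * `|phi i + d - phi j|)%R.
    by apply: Num.Theory.ler_wpM2l; [lia | rewrite /D in D0; lia].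
  lia.
have [De|De] := eqVneq D 1%R.
  apply: Or32; rewrite De in o1 n1; split; first by rewrite /D in De; lia.
  lia.
apply: Or33; split; first by rewrite /D in De D1 *; lia.
have : (2 * k%:Z * 2 <= 2 * k%:Z * `|D|)%R by apply: Num.Theory.ler_wpM2l; lia.
lia.
Qed.

(** With both short gaps bypassed through [z], the two remaining closed walks have total length l
    and total net length d, and the bound for each gives 2kd <= l. *)
Lemma no_two_short s t : s + 2 <= t -> t + 2 <= s + l -> P s -> P (s + 2) -> P t -> P (t + 2) ->
  phi (s + 2) = phi s -> phi (t + 2) = phi t -> False.
Proof.
move=> st ts Ps Ps2 Pt Pt2 es et.
have w1 := arc st Ps2 Pt; rewrite es in w1.
have Psl : P (s + l) by rewrite P_per.
have w2 := arc ts Pt2 Psl; rewrite phi_per et in w2.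
have n1 := NV (ltac:(lia) : (t - (s + 2)).+2 < l) w1.
have n2 := NV (ltac:(lia) : (s + l - (t + 2)).+2 < l) w2.
have : (2 * k%:Z * d <= 2 * k%:Z * (`|phi t - phi s| + `|phi s + d - phi t|))%R.
  by apply: Num.Theory.ler_wpM2l; lia.
by rewrite mulrDr; lia.
Qed.

(** All gaps between successive neighbours have length at least 2k-1, except at most one of length
    2; that exception costs the correction 2k-3. *)
Lemma count_gaps i0 n : P i0 -> 2 < count P (iota i0 l) -> n <= l -> P (i0 + n) ->
  (2 * k - 1) * count P (iota i0 n) <= n \/
  exists s, [/\ i0 <= s, s + 2 <= i0 + n, P s, P (s + 2) & phi (s + 2) = phi s] /\
    (2 * k - 1) * count P (iota i0 n) <= n + (2 * k - 3).
Proof.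
move=> P0 c3; elim/ltn_ind: n => n IH nl Pn.
have [->|n0] := posnP n; first by left; rewrite muln0.
have ex : exists m, (m < n) && P (i0 + m) by exists 0; rewrite n0 addn0.
have bd m : (m < n) && P (i0 + m) -> m <= n by case/andP; lia.
case: (ex_maxnP ex bd) => m /andP[mn Pm] mmax.
have cE : count P (iota i0 n) = (count P (iota i0 m)).+1.
  have c0 : count P (iota (i0 + m).+1 (n - m.+1)) = 0.
    apply/eqP; rewrite -leqn0 leqNgt -has_count; apply/hasPn => u.
    rewrite mem_iota => /andP[u1 u2]; apply/negP => Pu.
    have := mmax (u - i0); rewrite subnKC; last by lia.
    by rewrite Pu andbT => /(_ ltac:(lia)); lia.
  have -> : iota i0 n = iota i0 m ++ (i0 + m) :: iota (i0 + m).+1 (n - m.+1).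
    by rewrite -[_ :: _]/(iota (i0 + m) (n - m.+1).+1) -iotaD; congr iota; lia.
  by rewrite count_cat /= Pm c0 addn0 addn1.
(* A third neighbour on the complementary arc gives that arc length at least 4, as [gap]
   requires. *)
have [u [nu mu Pu]] : exists u, [/\ i0 + n < u, u < i0 + m + l & P u].
  have [u []] := @third_index P (iota i0 l) (i0 + m) (if n == l then i0 else i0 + n) (iota_uniq _ _) c3.
  rewrite mem_iota => /andP[u1 u2] Pu um un.
  have [ult|ugt] := ltnP u (i0 + m).
    exists (u + l); rewrite P_per; split=> //; last by lia.
    by case: eqP un => nl' un; lia.
  exists u; split=> //; last by lia.
  have [un'|//] := leqP u (i0 + n).
  have [ule|une] := eqVneq u (i0 + n).
    by case: eqP un => nl' un; lia.
  have := mmax (u - i0); rewrite subnKC; last by lia.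
  by rewrite Pu andbT => /(_ ltac:(lia)); lia.
have h1 : u != (i0 + n).+1 by apply/eqP=> ue; have := P_next Pn; rewrite -ue Pu.
have h2 : i0 + m + l != u.+1.
  by apply/eqP=> ue; have := P_next Pu; rewrite -ue P_per Pm.
have g := @gap (i0 + m) (i0 + n) ltac:(lia) ltac:(lia) Pm Pn.
have := IH m mn ltac:(lia) Pm; rewrite cE mulnS.
case: g => [[e2 ep]|[_ g]|[_ g]].
- case=> [le|[s [[s0 sm Ps Ps2 es] le]]].
    right; exists (i0 + m); rewrite -e2; split; last by lia.
    by split=> //; lia.
  rewrite e2 in Pn ep.
  by case: (@no_two_short s (i0 + m)) => //; lia.
- case=> [le|[s [[s0 sm Ps Ps2 es] le]]]; first by left; lia.
  by right; exists s; split; [split=> //; lia | lia].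
- case=> [le|[s [[s0 sm Ps Ps2 es] le]]]; first by left; lia.
  by right; exists s; split; [split=> //; lia | lia].
Qed.

Lemma count_window i0 : i0 <= l -> count P (iota i0 l) = count P (iota 0 l).
Proof.
move=> il; have -> : iota 0 l = iota 0 i0 ++ iota i0 (l - i0).
  by rewrite -{2}[i0]add0n -iotaD subnKC.
have -> : iota i0 l = iota i0 (l - i0) ++ iota l i0.
  by rewrite -{3}(subnKC il) -iotaD subnK.
rewrite !count_cat addnC; congr (_ + _).
rewrite -[l in iota l]addn0 iotaDl count_map; apply: eq_count => i /=.
by rewrite addnC P_per.
Qed.

(** With a short gap, (2k-1)c <= l + 2k-3 suffices exactly from c = 4 on. For c = 3 the two long
    gaps are inspected: if both raise the height by one, then d = 2 and l >= 4k contradicts [viol];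
    otherwise one is at least 4k-2 and l >= 6k-1. *)
Lemma count_min : 2 < count P (iota 0 l) -> count P (iota 0 l) * (6 * k - 1) <= 4 * l.
Proof.
move=> c3.
have [i0 i0l P0] : exists2 i0, i0 < l & P i0.
  have /hasP[i] : has P (iota 0 l) by rewrite has_count; lia.
  by rewrite mem_iota; exists i.
rewrite -(count_window (ltnW i0l)) in c3 *.
have [] := count_gaps P0 c3 (leqnn l) _; rewrite ?P_per //.
  by set c := count _ _; nia.
case=> s [[s0 sl Ps Ps2 es] le].
have [c4|c3'] := ltnP 3 (count P (iota i0 l)).
  by move: le c4; set c := count _ _; nia.
have ce : count P (iota i0 l) = 3 by lia.
have [u [u1 u2 Pu]] : exists u, [/\ s + 2 < u, u < s + l & P u].
  have [u []] := @third_index P (iota i0 l) s (if s + 2 == i0 + l then i0 else s + 2) (iota_uniq _ _) c3.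
  rewrite mem_iota => /andP[u1 u2] Pu us us2.
  have h : u != s.+1 by apply/eqP=> ue; have := P_next Ps; rewrite -ue Pu.
  have [ult|ugt] := ltnP u s.
    exists (u + l); rewrite P_per; split=> //; last by lia.
    by case: eqP us2 => ? ?; lia.
  by exists u; split=> //; case: eqP us2 => ? ?; lia.
have h1 : u != (s + 2).+1 by apply/eqP=> ue; have := P_next Ps2; rewrite -ue Pu.
have h2 : s + l != u.+1 by apply/eqP=> ue; have := P_next Pu; rewrite -ue P_per Ps.
have Psl : P (s + l) by rewrite P_per.
have g1 := @gap (s + 2) u ltac:(lia) ltac:(lia) Ps2 Pu.
have g2 := @gap u (s + l) ltac:(lia) ltac:(lia) Pu Psl.
rewrite phi_per es in g1 g2; rewrite ce.
case: g1 => [[u2' ep]|[p1 g1]|[p1 g1]].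
- by rewrite u2' in Pu ep *; case: (@no_two_short s (s + 2)); rewrite ?es //; lia.
- case: g2 => [[sl' ep]|[p2 g2]|[p2 g2]]; last by lia.
    rewrite sl' in Psl ep; case: (@no_two_short s u) => //; lia.
  have d2 : d = 2%R by lia.
  by move: viol; rewrite d2; lia.
- case: g2 => [[sl' ep]|[p2 g2]|[p2 g2]]; try by lia.
  by rewrite sl' -phi_per in Psl ep; rewrite sl' in ep; case: (@no_two_short s u) => //; lia.
Qed.

End MinimalWalk.

End Winding.

(** * The potential and the map to the ladder *)

Lemma nat_min (Q : nat -> Prop) : (exists n, Q n) -> exists n, Q n /\ forall m, Q m -> n <= m.
Proof.
case=> n; elim/ltn_ind: n => n IH Qn.
have [[m [mn Qm]]|no] := classic (exists m, m < n /\ Q m); first exact: IH mn Qm.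
by exists n; split=> // m Qm; rewrite leqNgt; apply/negP => mn; apply: no; exists m.
Qed.

Lemma modn_addM p m d : m + p * d = m %[mod d].
Proof. by rewrite addnC modnMDl. Qed.

Section Mobius.
Variables (k : nat) (k2 : 1 < k).
Let r := 4 * k.

Lemma mobius_succ (i j : 'I_r) : i.+1 = j %[mod r] -> mobius_adj i j.
Proof.
move=> ij; have ltj := ltn_ord j; have lti := ltn_ord i.
have je : i.+1 %% r = j by rewrite ij modn_small.
have ne : i != j.
  apply/eqP => eij; move: je; rewrite -eij.
  have [il|ig] := ltnP i.+1 r; first by rewrite modn_small //; lia.
  have -> : i.+1 = r by lia.
  by rewrite modnn => i0; rewrite -i0 in ig; rewrite /r in ig; lia.
by rewrite /mobius_adj ne /cycle_adj ne je eqxx.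
Qed.

(** Here [u] counts the forward steps and [w] the backward ones; this bounds distances on the cycle
    from below. *)
Lemma cycle_path_mod (x : 'I_r) p : path (@cycle_adj r) x p ->
  exists u w, u + w = size p /\ x + u = last x p + w %[mod r].
Proof.
elim: p x => [|y p IH] x /=; first by exists 0, 0.
case/andP=> /andP[_ xy] /IH[u [w [uw h]]].
case/orP: xy => /eqP xy.
- exists u.+1, w; split; first by lia.
  by rewrite addnS -addSn -modnDml xy.
- exists u, w.+1; split; first by lia.
  by rewrite addnS -addn1 -[RHS]modnDml -h modnDml addn1 -addSn -[in RHS]modnDml xy.
Qed.

Lemma mobius_opp (i j : 'I_r) : i + 2 * k = j %[mod r] -> mobius_adj i j.
Proof.
move=> ij; have ltj := ltn_ord j; have lti := ltn_ord i.
have je : (i + 2 * k) %% r = j by rewrite ij modn_small.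
have r0 : 0 < r by rewrite /r; lia.
pose f s : 'I_r := Ordinal (ltn_pmod (i + s) r0).
have fi : f 0 = i by apply: val_inj; rewrite /= addn0 modn_small.
have fj : f (2 * k) = j by apply: val_inj.
have ne : i != j.
  apply/eqP => eij; move/eqP: ij; rewrite -eij -{2}[val i]addn0 eqn_modDl mod0n.
  by rewrite modn_small /r; lia.
rewrite /mobius_adj ne; apply/orP; right.
have -> : r./2 = 2 * k by rewrite /r; lia.
apply/andP; split.
  have sz : size [seq f s | s <- iota 1 (2 * k)] == 2 * k by rewrite size_map size_iota.
  apply/existsP; exists (Tuple sz) => /=.
  rewrite -{1}fi path_map_iota /=; last first.
    move=> s _; have st : (i + s) %% r != (i + s.+1) %% r.
      by rewrite eqn_modDl -[s.+1]addn1 -{1}[s]addn0 eqn_modDl mod0n modn_small // /r; lia.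
    rewrite /cycle_adj -val_eqE /= st /=; apply/orP; left.
    by rewrite -addn1 modnDml addn1 addnS.
  rewrite -{1}fi last_map -nth_last size_iota nth_iota; last by lia.
  have -> : 1 + (2 * k).-1 = 2 * k by lia.
  by rewrite fj.
(* A shorter walk would give u = 2k + w modulo 4k with u + w < 2k, which is impossible. *)
apply/forallP => d; rewrite negb_exists; apply/forallP => p; apply/negP => /andP[ip /eqP lp].
have [u [w [uw h]]] := cycle_path_mod ip.
rewrite lp size_tuple in uw h; have ltd := ltn_ord d.
move/eqP: h; rewrite -je modnDml -addnA eqn_modDl => /eqP.
by rewrite !modn_small; rewrite /r; lia.
Qed.

Lemma mobius_hom (V : finType) (e : rel V) (c : V -> nat) : symmetric e ->
  (forall a b, e a b -> c a <= c b -> 2 * k - 1 <= c b - c a <= 2 * k + 1) ->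
  exists f : V -> 'I_r, forall a b, e a b -> mobius_adj (f a) (f b).
Proof.
move=> es ce; have r0 : 0 < r by rewrite /r; lia.
exists (fun v => Ordinal (ltn_pmod (c v * (2 * k - 1)) r0)).
suff main a b : e a b -> c a <= c b ->
  mobius_adj (Ordinal (ltn_pmod (c a * (2 * k - 1)) r0)) (Ordinal (ltn_pmod (c b * (2 * k - 1)) r0)).
  move=> a b ab; have [le|/ltnW le] := leqP (c a) (c b); first exact: main.
  by rewrite mobius_adj_sym; apply: main => //; rewrite es.
move=> ab le; have /andP[t1 t2] := ce _ _ ab le.
have cb : c b = c a + (c b - c a) by lia.
have : [\/ c b - c a = 2 * k - 1, c b - c a = 2 * k | c b - c a = 2 * k + 1].
  have : c b - c a = 2 * k - 1 \/ c b - c a = 2 * k \/ c b - c a = 2 * k + 1 by lia.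
  by case=> [->|[->|->]]; [apply: Or31|apply: Or32|apply: Or33].
case=> te; rewrite te in cb.
- apply: mobius_succ; rewrite /= modn_mod -addn1 modnDml cb mulnDl.
  have -> : c a * (2 * k - 1) + (2 * k - 1) * (2 * k - 1) = c a * (2 * k - 1) + 1 + (k - 1) * r.
    by rewrite /r; nia.
  by rewrite modn_addM.
- apply: mobius_opp; rewrite /= modn_mod modnDml cb mulnDl.
  have -> : c a * (2 * k - 1) + (2 * k) * (2 * k - 1) = c a * (2 * k - 1) + 2 * k + (k - 1) * r.
    by rewrite /r; nia.
  by rewrite modn_addM.
- rewrite mobius_adj_sym; apply: mobius_succ; rewrite /= modn_mod -addn1 modnDml cb mulnDl.
  have -> : c a * (2 * k - 1) + (2 * k + 1) * (2 * k - 1) + 1 = c a * (2 * k - 1) + k * r.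
    by rewrite /r; nia.
  by rewrite modn_addM.
Qed.

End Mobius.

Section Potential.
Import GRing.Theory.
Variables (V : finType) (e : rel V) (k : nat) (v0 : V) (col : V -> bool).
Hypotheses (k2 : 1 < k) (e_sym : symmetric e) (og : no_short_odd e k).
Hypothesis dns : dense e k.
Hypothesis col_proper : forall a b, ~~ e v0 a -> ~~ e v0 b -> e a b -> col a != col b.
Let sgc := sg e v0 col.
Let nwk := nwlk e v0 col.

(** By strong induction a violating walk is a shortest one. Let m be the largest number of positions
    on it adjacent to one vertex: m >= 3 is refuted by [count_min], and m <= 2 by its length. *)
Lemma net_bound l d x : nwk l d x x -> (2 * k%:Z * `|d| <= l%:Z)%R.
Proof.
elim/ltn_ind: l d x => l IH.
suff main d x : (0 <= d)%R -> nwk l d x x -> (2 * k%:Z * `|d| <= l%:Z)%R.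
  move=> d x w; have [d0|d0] := Order.TotalTheory.leP 0%R d; first exact: main d0 w.
  by rewrite -Num.Theory.normrN; apply: (main _ x); [lia | exact: nwlk_rev k2 e_sym og col_proper _ _ _ _ w].
move=> d0 w; have [//|viol] := Order.TotalTheory.leP (2 * k%:Z * `|d|)%R (l%:Z)%R.
rewrite Num.Theory.ger0_norm // in viol.
have dpos : (0 < d)%R.
  by case: (Order.TotalTheory.ltgtP d 0%R) d0 => // de _; move: viol; rewrite de mulr0; lia.
have hub := hub_closed k2 e_sym og col_proper w; rewrite Num.Theory.ger0_norm // in hub.
(* Net length 1 would make the walk odd, hence longer than 2k; with d >= 2 the rank bound gives l >=
   4k-2. *)
have d2 : (2 <= d)%R.
  have [//|d1] := Order.TotalTheory.leP 2%R d; have de : d = 1%R by lia.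
  have ol : odd l by rewrite -(nwlk_odd k2 w) de.
  by have := og ol (nwlk_wlk w); rewrite de in viol; lia.
have l4 : 4 * k - 2 <= l by move: hub; nia.
have l0 : 0 < l by lia.
have [f [[f0 fl fP] dE]] := nwlk_funP w.
pose F i := f (i %% l).
have Fper i : F (i + l) = F i by rewrite /F modnDr.
have FS m : m < l -> F m.+1 = f m.+1.
  rewrite leq_eqVlt => /predU1P[->|ml]; first by rewrite /F modnn f0 fl.
  by rewrite /F modn_small.
have Fl m : m < l -> F m = f m by move=> ml; rewrite /F modn_small.
have FP i : e (F i) (F i.+1).
  have -> : F i = F (i %% l) by rewrite /F modn_mod.
  have -> : F i.+1 = F (i %% l).+1 by rewrite /F -[(i %% l).+1]addn1 modnDml addn1.
  by rewrite Fl ?FS ?fP // ltn_pmod.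
have HF : (\sum_(0 <= m < l) sgc (F m) (F m.+1))%R = d.
  by rewrite dE; apply: eq_big_nat => m /andP[_ ml]; rewrite Fl ?FS.
have NV l' d' y (ll : l' < l) (ww : nwk l' d' y y) := IH l' ll d' y ww.
pose s := [seq F i | i <- iota 0 l].
have ce z : count (e z) s = count (fun i => e z (F i)) (iota 0 l) by rewrite count_map.
have ss : size s = l by rewrite size_map size_iota.
pose m := \max_z count (e z) s.
have [m2|m2] := leqP m 2.
  have := @dense_count _ _ e_sym k 2 s dns _ _; rewrite ss -size_eq0 ss.
  move=> /(_ ltac:(lia)) /(_ (fun z => leq_trans (leq_bigmax z) m2)); lia.
have [|z mz] := @eq_bigmax V (fun z => count (e z) s); first by apply/card_gt0P; exists x.
rewrite -/m in mz.
have := @dense_count _ _ e_sym k m s dns _ _; rewrite ss -size_eq0 ss.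
move=> /(_ ltac:(lia)) /(_ (fun z => leq_bigmax z)).
have := @count_min V e k v0 col k2 e_sym og col_proper l d F Fper FP HF dpos viol NV z.
by rewrite -ce -mz => /(_ m2); lia.
Qed.

Lemma nwlk_le l d x y : nwk l d x y -> (`|d| <= l%:Z)%R.
Proof.
elim: l d x => [|l IH] d x /=; first by case=> _ ->.
by case=> z _ /IH; rewrite /sg; case: ifP; lia.
Qed.

(** Closed subwalks have nonnegative weight and can be cut out until fewer than |V| steps remain,
    each of weight at least -2k. *)
Lemma weight_bound l d x y : nwk l d x y -> (0 <= l%:Z + 2 * k%:Z * d + 2 * k%:Z * #|V|%:Z)%R.
Proof.
elim/ltn_ind: l d x y => l IH d x y w.
have [lV|Vl] := ltnP l #|V|; first by have := nwlk_le w; nia.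
have [f [[f0 fl fP] dE]] := nwlk_funP w.
have : ~~ injectiveb (fun i : 'I_l.+1 => f i).
  apply/negP => /injectiveP /leq_card; rewrite card_ord; lia.
case/injectivePn => i [j ij fij].
wlog {ij} ij : i j fij / i < j.
  move=> H; have [ji|ji|ji] := ltngtP i j; [exact: (H i j)| exact: (H j i)|].
  by case/eqP: ij; apply: val_inj.
have lj : j <= l by rewrite -ltnS.
have w1 := @nwlk_fun V e k v0 col k2 f 0 i (fun m mi => fP m ltac:(lia)) isT.
have w2 := @nwlk_fun V e k v0 col k2 f i j (fun m mi => fP m ltac:(lia)) (ltnW ij).
have w3 := @nwlk_fun V e k v0 col k2 f j l (fun m mi => fP m ltac:(lia)) lj.
rewrite -fij in w2 w3; have w13 := nwlk_cat w1 w3.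
have b2 := net_bound w2; have := IH _ _ _ _ _ w13 => /(_ ltac:(lia)).
have := dE; rewrite (@big_cat_nat _ _ _ i) //=; last by lia.
rewrite (@big_cat_nat _ _ _ j i l) //=; last by lia.
move: b2; set a := (\sum_(0 <= _ < _) _)%R; set b := (\sum_(_ <= _ < j) _)%R; set c := (\sum_(_ <= _ < l) _)%R.
move=> b2 -> b13; move: b2 b13; nia.
Qed.

(** The potential is the least weight of a walk ending at the given vertex, shifted by 2k|V| to be
    natural; extending an optimal walk along an edge in either direction gives the two bounds on its
    change. *)
Lemma colored_hom : exists f : V -> 'I_(4 * k), forall a b, e a b -> mobius_adj (f a) (f b).
Proof.
pose Q v n := exists l d x, nwk l d x v /\ (n%:Z = l%:Z + 2 * k%:Z * d + 2 * k%:Z * #|V|%:Z)%R.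
have [|c cP] := @fin_all_exists V (fun=> nat) (fun v n => Q v n /\ forall m, Q v m -> n <= m).
  move=> v; apply: nat_min; exists (2 * k * #|V|), 0, 0%R, v; split=> //; lia.
have step a b : e a b -> ((c b)%:Z <= (c a)%:Z + 1 + 2 * k%:Z * sgc a b)%R.
  move=> ab; case: (cP a) => [[l [d [x [w ca]]]] _]; case: (cP b) => _ /(_ _) bmin.
  have w' := nwlk_cat w (nwlk1 v0 col ab); have b0 := weight_bound w'.
  have /bmin : Q b `|((l + 1)%:Z + 2 * k%:Z * (d + sgc a b) + 2 * k%:Z * #|V|%:Z)%R|%N.
    exists (l + 1), (d + sgc a b)%R, x; split=> //.
    exact: gez0_abs.
  move: b0; rewrite -/sgc; nia.
apply: (@mobius_hom k k2 V e c e_sym) => a b ab le.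
have s1 := step _ _ ab; have := step b a; rewrite e_sym ab => /(_ isT).
rewrite /sgc (sgN k2 e_sym og col_proper ab) -/(sgc a b); move: s1; rewrite /sgc /sg; case: ifP => _; nia.
Qed.

End Potential.

(** * Bipartiteness off a neighbourhood, k = 2 *)

(** The colour of a vertex is the parity of a walk from the root of its component. *)
Lemma two_color (V : finType) (r : rel V) : symmetric r ->
  (forall d x, odd d -> ~~ wlk r d x x) -> exists col : V -> bool, forall a b, r a b -> col a != col b.
Proof.
move=> rs nodd; have cs := sym_connect_sym rs.
have [a|col colP] := @fin_all_exists V (fun=> bool)
    (fun a s => exists2 d, odd d = s & wlk r d (fingraph.root r a) a).
  have /connectP[p] : connect r (fingraph.root r a) a by rewrite cs connect_root.
  elim: p (fingraph.root r a) => [|b p IH] c /= => [_ ->|/andP[cb bp] /IH - /(_ bp)[s [d ds da]]].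
    by exists false, 0 => //; apply: wlk0.
  by exists (~~ s), d.+1; [rewrite /= ds | apply: wlkS cb da].
exists col => a b ab; apply/negP => /eqP cab.
have [da dae wa] := colP a; have [db dbe wb] := colP b.
have rab : fingraph.root r a = fingraph.root r b by apply/eqP; rewrite fingraph.root_connect // connect1.
rewrite rab in wa; have w1 : wlk r 1 a b by rewrite wlk1.
have /negP[] : ~~ wlk r (da + 1 + db) (fingraph.root r b) (fingraph.root r b).
  by apply: nodd; rewrite !oddD dae dbe cab; case: (col b).
exact: wlk_cat (wlk_cat wa w1) (wlk_sym rs wb).
Qed.

Lemma nat_minb (Q : pred nat) : (exists n, Q n) -> exists n, Q n /\ forall m, Q m -> n <= m.
Proof. by move=> ex; exists (ex_minn ex); case: ex_minnP. Qed.

Lemma shortest_odd (V : finType) (r : rel V) : (exists d x, odd d && wlk r d x x) ->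
  exists l (F : nat -> V), [/\ forall i, F (i + l.*2.+1) = F i, forall i, r (F i) (F i.+1) &
    forall d x, odd d -> wlk r d x x -> l.*2.+1 <= d].
Proof.
move=> [d0 [x0 w0]].
have [|m [/existsP[x /andP[om w]] mmin]] := @nat_minb (fun d => [exists x, odd d && wlk r d x x]).
  by exists d0; apply/existsP; exists x0.
have mE : m = m./2.*2.+1 by lia.
have [f [f0 fm fP]] := wlk_funP w.
exists m./2, (fun i => f (i %% m)); rewrite -mE; split=> [i|i|d y od wd].
- by rewrite modnDr.
- have m0 : 0 < m by lia.
  have im := ltn_pmod i m0; rewrite -[i.+1]addn1 -modnDml addn1.
  have [lt|le] := ltnP (i %% m).+1 m; first by rewrite (modn_small lt) fP.
  have e : (i %% m).+1 = m by lia.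
  by rewrite e modnn f0 -fm -[in f m]e fP.
- by apply: mmin; apply/existsP; exists y; rewrite od.
Qed.

Lemma count3 (P : pred nat) m : 2 < count P (iota 0 m) ->
  exists a b c, [/\ a < b, b < c, c < m, P a & P b /\ P c].
Proof.
move=> c3; have [a [am Pa _ _]] := @third_index P (iota 0 m) 0 0 (iota_uniq _ _) c3.
have ex : exists a, P a && (a < m) by exists a; rewrite Pa; move: am; rewrite mem_iota.
case: (ex_minnP ex) => {am Pa}a /andP[Pa am] amin.
have bd j : P j && (j < m) -> j <= m by case/andP; lia.
case: (ex_maxnP ex bd) => c /andP[Pc cm] cmax.
have [b []] := @third_index P (iota 0 m) a c (iota_uniq _ _) c3.
rewrite mem_iota => /andP[_ bm] Pb ba bc.
have h1 := amin b; have h2 := cmax b; rewrite Pb bm in h1 h2.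
by exists a, b, c; split=> //; [have := h1 isT|have := h2 isT]; lia.
Qed.

Lemma count_sparse (P : pred nat) m : (forall i, P i -> ~~ P i.+1) -> P m = P 0 ->
  2 * count P (iota 0 m) <= m.
Proof.
move=> sp per; suff h j : 2 * count P (iota 0 j) + P j <= j + P 0 by have := h m; rewrite per; lia.
elim: j => [|j IH] //; have -> : iota 0 j.+1 = iota 0 j ++ [:: j] by rewrite -addn1 iotaD.
rewrite count_cat /= addn0.
have [Pj|] := boolP (P j); have [Pj1|] := boolP (P j.+1); rewrite ?Pj /=; try lia.
by have := sp _ Pj; rewrite Pj1.
Qed.

Section Common.
Variables (V : finType) (e : rel V) (k : nat).
Hypotheses (e_sym : symmetric e) (og : no_short_odd e k).

(** The parity rule: the walk closes up through [z] to an odd closed walk of length d + 2. *)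
Lemma see z a b d : e z a -> e z b -> wlk e d a b -> odd d -> 2 * k <= d.+1.
Proof.
move=> za zb ab od; have bz : wlk e 1 b z by rewrite wlk1 e_sym.
have := wlkS za (wlk_cat ab bz); rewrite addn1; apply: (@og d.+2 z).
by rewrite /= negbK.
Qed.

Lemma adj_odd a b d : e a b -> wlk e d a b -> ~~ odd d -> 2 * k <= d.
Proof.
move=> ab w od; have ba : wlk e 1 b a by rewrite wlk1 e_sym.
by have := wlk_cat w ba; rewrite addn1 => /(@og d.+1 a od).
Qed.

End Common.

(** * No closed walk of length 5 avoids N(v) when k = 2 *)

Section Pentagon.
Variables (V : finType) (e : rel V) (D : nat).
Hypotheses (e_sym : symmetric e) (og : no_short_odd e 2) (sat : saturated e 2).
Let n := #|V|.
Hypothesis degD : forall w, D <= #|[set z | e w z]|.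
Hypothesis D11 : 4 * n < 11 * D.

Lemma deg_sum w : D <= \sum_z (e w z : nat).
Proof.
apply: leq_trans (degD w) _; rewrite -sum1dep_card big_mkcond leq_sum //.
Qed.

Lemma sum_le_n (f : V -> nat) : (forall z, f z <= 1) -> \sum_z f z <= n.
Proof. by move=> f1; rewrite /n -sum1_card leq_sum. Qed.

Lemma sum_off (y : V) (f : V -> nat) : (forall z, f z + e y z <= 1) -> \sum_z f z + D <= n.
Proof.
by move=> f1; apply: leq_trans (sum_le_n f1); rewrite big_split leq_add2l deg_sum.
Qed.

Let tri a b c : e a b -> e b c -> ~~ e a c.
Proof. by move=> ab bc; apply/negP; apply: (no_triangle _ e_sym og ab bc). Qed.

Variable v : V.
Let S z := e v z.
Let d := \sum_z (S z : nat).

Definition pent b0 b1 b2 b3 b4 :=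
  [&& e b0 b1, e b1 b2, e b2 b3, e b3 b4, e b4 b0 & all (fun b => ~~ e v b) [:: b0; b1; b2; b3; b4]].

Lemma pent_rot b0 b1 b2 b3 b4 : pent b0 b1 b2 b3 b4 -> pent b1 b2 b3 b4 b0.
Proof. by rewrite /pent /= => /and5P[-> -> -> -> /andP[-> /and5P[-> -> -> -> /andP[-> _]]]]. Qed.

(** The sets N(b0) ∩ N(b2), N(b3) and N(b4) are pairwise disjoint because there are no triangles. *)
Lemma pent_A b0 b1 b2 b3 b4 : pent b0 b1 b2 b3 b4 -> \sum_z (e b0 z && e b2 z : nat) + 2 * D <= n.
Proof.
case/and5P=> e01 e12 e23 e34 /andP[e40 _].
apply: leq_trans (sum_le_n (f := fun z => (e b0 z && e b2 z) + (e b3 z + e b4 z)) _) => [|z].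
  by rewrite !big_split /= leq_add2l; have := deg_sum b3; have := deg_sum b4; lia.
move: (@tri _ _ z e23) (@tri _ _ z e34) (@tri _ _ z e40).
by case: (e b0 z) (e b2 z) (e b3 z) (e b4 z) => [] [] [] [] // h1 h2 h3; 
  try (have := h1 isT); try (have := h2 isT); try (have := h3 isT).
Qed.

Lemma common_nbr b : ~~ e v b -> exists2 y, S y & e b y.
Proof.
move/sat => /existsP[y /andP[vy yb]]; have {yb} : wlk e 1 y b := yb.
by rewrite wlk1 e_sym => yb; exists y.
Qed.

(** Inclusion and exclusion for N(v), N(b0), N(b2): sets whose centres share a neighbour [y] have a
    union disjoint from N(y), hence of size at most n - D. If no such [y] serves all three sets, the
    pairs N(v), N(b0) and N(v), N(b2) are treated separately. *)
Lemma pent_B b0 b1 b2 b3 b4 : pent b0 b1 b2 b3 b4 ->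
  d + 5 * D <= \sum_z (S z && (e b0 z || e b2 z) : nat) + 2 * n.
Proof.
move=> pb; have A := pent_A pb; case/and5P: pb => _ _ _ _ /and5P[_ n0 _ n2 _].
have s0 := deg_sum b0; have s2 := deg_sum b2; have sv : D <= d := deg_sum v.
have [/existsP[y /and3P[Sy y0 y2]]|no] := boolP [exists y, [&& S y, e b0 y & e b2 y]].
  have := @sum_off y (fun z => [|| S z, e b0 z | e b2 z]) _.
  have : \sum_z ([|| S z, e b0 z | e b2 z] + (S z && (e b0 z || e b2 z)) + (e b0 z && e b2 z)) =
         \sum_z (S z + (e b0 z + e b2 z)).
    by apply: eq_bigr => z _; case: (S z) (e b0 z) (e b2 z) => [] [] [].
  rewrite !big_split /= -/d => E h; move: E; have {h} : \sum_z [|| S z, e b0 z | e b2 z] + D <= n.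
    apply: h => z; case yz: (e y z); last by case: orb.
    by rewrite /S (negPf (tri Sy yz)) (negPf (tri y0 yz)) (negPf (tri y2 yz)).
  lia.
have [y0 Sy0 y00] := common_nbr n0; have [y2 Sy2 y22] := common_nbr n2.
have h0 : \sum_z (S z || e b0 z : nat) + D <= n.
  apply: (@sum_off y0) => z; case yz: (e y0 z); last by case: orb.
  by rewrite /S (negPf (tri Sy0 yz)) (negPf (tri y00 yz)).
have h2 : \sum_z (S z || e b2 z : nat) + D <= n.
  apply: (@sum_off y2) => z; case yz: (e y2 z); last by case: orb.
  by rewrite /S (negPf (tri Sy2 yz)) (negPf (tri y22 yz)).
have : \sum_z ((S z || e b0 z) + (S z || e b2 z) + (S z && (e b0 z || e b2 z))) =
         \sum_z ((S z + S z) + (e b0 z + e b2 z)).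
  apply: eq_bigr => z _; move: no; rewrite negb_exists => /forallP/(_ z).
  by case: (S z) (e b0 z) (e b2 z) => [] [] [].
rewrite !big_split /= -/d; lia.
Qed.

(** Otherwise N(b2) ∪ N(b4) and N(b3) ∪ N(b0) are disjoint inside N(v), and two instances of
    [pent_B] add up to 11D <= 4n. *)
Lemma pent_meet b0 b1 b2 b3 b4 : pent b0 b1 b2 b3 b4 -> exists y, [&& S y, e b0 y & e b2 y].
Proof.
move=> p0; have p2 := pent_rot (pent_rot p0); have B2 := pent_B p2; have B3 := pent_B (pent_rot p2).
apply/existsP; rewrite -[[exists _, _]]negbK negb_exists; apply/negP => /forallP no.
have sv : D <= d := deg_sum v.
case/and5P: p0 => e01 e12 e23 e34 /andP[e40 _].
have : \sum_z ((S z && (e b2 z || e b4 z)) + (S z && (e b3 z || e b0 z))) <= d.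
  apply: leq_sum => z _; move: (@tri _ _ z e23) (@tri _ _ z e34) (@tri _ _ z e40) (no z).
  by case: (S z) (e b0 z) (e b2 z) (e b3 z) (e b4 z) => [] [] [] [] [] //= h1 h2 h3 h4;
  try (have := h1 isT); try (have := h2 isT); try (have := h3 isT).
rewrite big_split /=; lia.
Qed.

(** Each of the five unions N(v) ∪ N(b_i) ∪ N(b_(i+2)) has size at most n - D. A vertex sees at most
    two of the b_i, never consecutive ones, which gives the pointwise inequality below and in sum
    17D <= 6n. *)
Lemma no_pent b0 b1 b2 b3 b4 : ~~ pent b0 b1 b2 b3 b4.
Proof.
apply/negP => p0; have p1 := pent_rot p0; have p2 := pent_rot p1; have p3 := pent_rot p2.
have p4 := pent_rot p3; have sv : D <= d := deg_sum v.
have T c0 c1 c2 c3 c4 : pent c0 c1 c2 c3 c4 -> \sum_z ([|| S z, e c0 z | e c2 z] : nat) + D <= n.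
  move=> p; have [y /and3P[Sy y0 y2]] := pent_meet p.
  apply: (@sum_off y) => z; case yz: (e y z); last by case: orb.
  by rewrite /S (negPf (tri Sy yz)) (negPf (tri y0 yz)) (negPf (tri y2 yz)).
have := T _ _ _ _ _ p0; have := T _ _ _ _ _ p1; have := T _ _ _ _ _ p2; have := T _ _ _ _ _ p3.
have := T _ _ _ _ _ p4; case/and5P: p0 => e01 e12 e23 e34 /andP[e40 _].
have s0 := deg_sum b0; have s1 := deg_sum b1; have s2 := deg_sum b2; have s3 := deg_sum b3; have s4 := deg_sum b4.
have : \sum_z ((S z + S z) + ((e b0 z + e b1 z + e b2 z + e b3 z + e b4 z) + (e b0 z + e b1 z + e b2 z + e b3 z + e b4 z))) <=
  \sum_z (1 + ([|| S z, e b0 z | e b2 z] + [|| S z, e b1 z | e b3 z] + [|| S z, e b2 z | e b4 z]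
     + [|| S z, e b3 z | e b0 z] + [|| S z, e b4 z | e b1 z])).
  apply: leq_sum => z _.
  move: (@tri _ _ z e01) (@tri _ _ z e12) (@tri _ _ z e23) (@tri _ _ z e34) (@tri _ _ z e40).
  by case: (S z) (e b0 z) (e b1 z) (e b2 z) (e b3 z) (e b4 z) => [] [] [] [] [] [] //= h1 h2 h3 h4 h5;
  try (have := h1 isT); try (have := h2 isT); try (have := h3 isT); try (have := h4 isT); try (have := h5 isT).
rewrite !big_split /= -/d sum1_card -/n; lia.
Qed.

End Pentagon.

Definition off_rel (V : finType) (e : rel V) v : rel V := fun a b => [&& ~~ e v a, ~~ e v b & e a b].

Lemma off_color (V : finType) (e : rel V) v : symmetric e ->
  (forall d x, odd d -> ~~ wlk (off_rel e v) d x x) ->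
  exists col : V -> bool, forall a b, ~~ e v a -> ~~ e v b -> e a b -> col a != col b.
Proof.
move=> es nodd; have [|col cP] := two_color _ nodd.
  by move=> a b; rewrite /off_rel (es a b) andbCA.
by exists col => a b va vb ab; apply: cP; rewrite /off_rel va vb.
Qed.

Lemma wlk_periodic (V : finType) (r : rel V) F i j :
  (forall i, r (F i) (F i.+1)) -> i <= j -> wlk r (j - i) (F i) (F j).
Proof. by move=> FP ij; apply: (@wlk_fun _ r F j). Qed.

Lemma sum_card_le (V : finType) (e : rel V) (s : seq V) D : (forall w, D <= #|[set z | e w z]|) ->
  D * size s <= \sum_(w <- s) #|[set z | e w z]|.
Proof.
move=> dD; elim: s => [|w s IH]; first by rewrite muln0.
by rewrite big_cons /= mulnS leq_add.
Qed.

(** Take a shortest odd closed walk off N(v), of length 2l+1 with l >= 3. Vertices off N(v) see it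
    at most twice and the D vertices of N(v) at most l times, so (2l+1)D <= 2n + (l-2)D and 3D <= n.
    Minimality of the degree of [v] makes |N(v)| equal to D. *)
Lemma color_off_min_degree (V : finType) (e : rel V) : symmetric e -> no_short_odd e 2 -> dense e 2 ->
  saturated e 2 -> 0 < #|V| ->
  exists v (col : V -> bool), forall a b, ~~ e v a -> ~~ e v b -> e a b -> col a != col b.
Proof.
move=> es og dns sat /card_gt0P[v1 _].
case: (@arg_minnP V v1 predT (fun w => #|[set z | e w z]|) isT) => v _ vmin.
set D := #|[set z | e v z]| in vmin; have D11 := dns v; rewrite -/D in D11.
have dD w : D <= #|[set z | e w z]| by apply: vmin.
exists v; apply: off_color => // d0 x0 od0; apply/negP => w0.
have [|l [F [Fper FP Fmin]]] := @shortest_odd V (off_rel e v); first by exists d0, x0; rewrite od0.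
have rs : symmetric (off_rel e v) by move=> a b; rewrite /off_rel (es a b) andbCA.
have Fe i : e (F i) (F i.+1) by have /and3P[] := FP i.
have Fv i : ~~ e v (F i) by have /and3P[] := FP i.
have l2 : 5 <= l.*2.+1.
  have := wlk_periodic Fe (leq0n l.*2.+1).
  have -> : F l.*2.+1 = F 0 by rewrite -[l.*2.+1]add0n Fper.
  by rewrite subn0 => /og; rewrite /= odd_double => /(_ isT); lia.
have [l2' | l3] : l = 2 \/ 3 <= l by lia.
  have /negP[] := @no_pent V e D es og sat dD D11 v (F 0) (F 1) (F 2) (F 3) (F 4).
  have F5 : F 5 = F 0 by have := Fper 0; rewrite l2'.
  have := Fe 4; rewrite F5 => F40.
  by rewrite /pent F40 !Fe /= !Fv.
pose s := [seq F i | i <- iota 0 l.*2.+1].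
have ss : size s = l.*2.+1 by rewrite size_map size_iota.
have cs z : count (e z) s = count (fun i => e z (F i)) (iota 0 l.*2.+1) by rewrite count_map.
clearbody s.
have tri a b c : e a b -> e b c -> e a c -> False.
  move=> ab bc ac; have : wlk e 3 a a by apply: (wlkS ab); apply: (wlkS bc); rewrite wlk1 es.
  by move/og => /(_ isT).
have cl z : count (e z) s <= l.
  have := @count_sparse (fun i => e z (F i)) l.*2.+1; rewrite -cs => h.
  have : 2 * count (e z) s <= l.*2.+1; last by lia.
  apply: h => [i zi|]; last by rewrite -[l.*2.+1]add0n Fper.
  by apply/negP => zi1; apply: (tri _ _ _ zi (Fe i) zi1).
have c2 z : ~~ e v z -> count (e z) s <= 2.
  move=> vz; rewrite leqNgt cs; apply/negP => /count3[a [b [c [ab bc cl' za [zb zc]]]]].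
  (* One of the two arcs is odd and closes through [z] to a closed walk still off N(v), so the other
     arc has length 2. Three positions pairwise two apart would need length 6. *)
  have near i j : i < j -> j < l.*2.+1 -> e z (F i) -> e z (F j) -> j = i + 2 \/ i + l.*2.+1 = j + 2.
    move=> ij jl zi zj.
    have ri : off_rel e v z (F i) by rewrite /off_rel vz Fv.
    have rj : off_rel e v (F j) z by rewrite /off_rel vz Fv es.
    have w1 : wlk (off_rel e v) (j - i + 1).+1 z z.
      by apply: (wlkS ri); apply: wlk_cat (wlk_periodic FP (ltnW ij)) _; rewrite wlk1.
    have w2 : wlk (off_rel e v) (i + l.*2.+1 - j + 1).+1 z z.
      apply: (@wlkS _ _ _ _ (F j)); first by rewrite rs.
      apply: wlk_cat (wlk_periodic FP (leq_trans (ltnW jl) (leq_addl _ _))) _.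
      by rewrite Fper wlk1 rs.
    have := Fmin _ _ _ w1; have := Fmin _ _ _ w2; clear - ij jl; lia.
  have bl := ltn_trans bc cl'; have ac := ltn_trans ab bc.
  have n1 := near a b ab bl za zb; have n2 := near b c bc cl' zb zc; have n3 := near a c ac cl' za zc.
  clear - ab bc cl' n1 n2 n3 l3; lia.
have lo := @sum_card_le V e s D dD; rewrite -sum_count // ss in lo.
have Dv : \sum_z (e v z : nat) = D by rewrite /D -sum1dep_card [RHS]big_mkcond; apply: eq_bigr => z _; case: (e v z).
have hi : \sum_z (count (e z) s + (e v z + e v z)) <= \sum_z (2 + l * e v z).
  by apply: leq_sum => z _; case vz: (e v z); [have := cl z|have := c2 z (negbT vz)]; lia.
rewrite !big_split /= -big_distrr /= Dv sum_nat_const in hi.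
have l3D : 3 * D <= l * D by rewrite leq_mul2r l3 orbT.
move: lo hi l3D D11; set X := \sum_z count _ _; rewrite -addn1 -muln2 /= mulnDr mulnA [D * l]mulnC muln1.
by move: X (l * D) #|V| => X Y N; clear; lia.
Qed.

(** * Ladders *)

Lemma count2 (P : pred nat) m : 1 < count P (iota 0 m) -> exists a b, [/\ a < b, b < m, P a & P b].
Proof.
move=> c2; have /hasP[a0 a0m Pa0] : has P (iota 0 m) by rewrite has_count; lia.
rewrite mem_iota in a0m; have ex : exists a, P a && (a < m) by exists a0; rewrite Pa0.
case: (ex_minnP ex) => a /andP[Pa am] amin.
have bd j : P j && (j < m) -> j <= m by case/andP; lia.
case: (ex_maxnP ex bd) => c /andP[Pc cm] cmax.
have ac : a <= c by apply: amin; rewrite Pc.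
have [e|ne] : a = c \/ a < c by lia.
  have : count P (iota 0 m) <= count (pred1 a) (iota 0 m).
    rewrite -!size_filter; apply: uniq_leq_size; first by rewrite filter_uniq ?iota_uniq.
    move=> u; rewrite !mem_filter mem_iota /= => /andP[Pu um]; rewrite um andbT.
    by have := amin u; have := cmax u; rewrite Pu um => /(_ isT) h1 /(_ isT) h2; apply/eqP; lia.
  by rewrite count_uniq_mem ?iota_uniq // => le; move: c2; case: (_ \in _) le; lia.
by exists a, c.
Qed.

Lemma count1 (P : pred nat) m : 0 < count P (iota 0 m) -> exists2 a, a < m & P a.
Proof. by rewrite -has_count => /hasP[a]; rewrite mem_iota; exists a. Qed.

Lemma count_le2 (P : pred nat) m :
  (forall a b c, a < b -> b < c -> c < m -> P a -> P b -> P c -> False) -> count P (iota 0 m) <= 2.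
Proof.
by move=> no; rewrite leqNgt; apply/negP => /count3[a [b [c [ab bc cm Pa [Pb Pc]]]]]; apply: (no a b c).
Qed.

Section Positions.
Variables (k g : nat).
Hypotheses (k3 : 2 < k) (gk : 3 <= g <= 2 * k - 3).
(** These four predicates record where one vertex may have two neighbours: on one rail, on opposite
    rails with rungs at 0 and [g], on the detour and the first rail, and on the detour and the
    second rail. The [crowded] lemmas exclude five neighbours by arithmetic alone. *)
Definition rail_gap i i' := i' = i + 2 \/ i = 0 /\ i' = 2 * k - 1.
Definition rails_gap i j := if odd (i + j) then i = j.+1 \/ j = i.+1 else
   2 * k - 2 <= i + j <= 2 * k + 2 /\ 2 * k - 2 <= (i - g) + (g - i) + ((j - g) + (g - j)).
Definition detour_gap t i := if odd (t + i) then t <= i + 1 /\ i <= t + 3 else t + i = 2 * k \/ i = 0 /\ t = 2 * k - 2.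
Definition detour_opp_gap t i := if odd (t + i) then 2 * k - 2 <= t + (i + 1) /\ i + t <= 2 * k + 1
   else i = t + 2 \/ i = 0 /\ t = 0.

Lemma odd_last : odd (2 * k - 1) = true.
Proof. clear -k3; lia. Qed.

Lemma crowded_rails i i' j j' t : i' < 2 * k -> j' < 2 * k -> t < 2 * k - 1 -> rail_gap i i' -> rail_gap j j' -> rails_gap i j -> rails_gap i j' -> rails_gap i' j -> rails_gap i' j' ->
  detour_gap t i -> detour_gap t i' -> detour_opp_gap t j -> detour_opp_gap t j' -> False.
Proof.
move=> ik jk tk; case=> [ie|[i0 ie]]; case=> [je|[j0 je]]; subst i' j'; try subst i; try subst j;
rewrite /rails_gap /detour_gap /detour_opp_gap ?add0n ?addn0 !(oddD, odd_last) /=; move: ik jk tk.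
- case: (odd i); case: (odd j); case: (odd t); rewrite /=; clear -k3 gk; lia.
- case: (odd i); case: (odd t); rewrite /=; clear -k3 gk; lia.
- case: (odd j); case: (odd t); rewrite /=; clear -k3 gk; lia.
- case: (odd t); rewrite /=; clear -k3 gk; lia.
Qed.

Lemma crowded_detour i i' j t t' : i' < 2 * k -> j < 2 * k -> t' < 2 * k - 1 -> rail_gap i i' -> t' = t + 2 -> rails_gap i j -> rails_gap i' j ->
  detour_gap t i -> detour_gap t i' -> detour_gap t' i -> detour_gap t' i' -> detour_opp_gap t j -> detour_opp_gap t' j -> False.
Proof.
move=> ik jk tk; case=> [ie|[i0 ie]] te; subst i' t'; try subst i;
rewrite /rails_gap /detour_gap /detour_opp_gap ?add0n ?addn0 !(oddD, odd_last) /=; move: ik jk tk.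
- case: (odd i); case: (odd j); case: (odd t); rewrite /=; clear -k3 gk; lia.
- case: (odd j); case: (odd t); rewrite /=; clear -k3 gk; lia.
Qed.

Lemma crowded_detour_opp i j j' t t' : i < 2 * k -> j' < 2 * k -> t' < 2 * k - 1 -> rail_gap j j' -> t' = t + 2 -> rails_gap i j -> rails_gap i j' ->
  detour_gap t i -> detour_gap t' i -> detour_opp_gap t j -> detour_opp_gap t j' -> detour_opp_gap t' j -> detour_opp_gap t' j' -> False.
Proof.
move=> ik jk tk; case=> [ie|[i0 ie]] te; subst j' t'; try subst j;
rewrite /rails_gap /detour_gap /detour_opp_gap ?add0n ?addn0 !(oddD, odd_last) /=; move: ik jk tk.
- case: (odd i); case: (odd j); case: (odd t); rewrite /=; clear -k3 gk; lia.
- case: (odd i); case: (odd t); rewrite /=; clear -k3 gk; lia.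
Qed.
End Positions.

Section Ladder.
Variables (V : finType) (e : rel V) (k : nat).
Hypotheses (k3 : 2 < k) (e_sym : symmetric e) (og : no_short_odd e k).
Hypotheses (dns : dense e k) (sat : saturated e k).

(* A closed walk of length [4 * k] in which positions [0] and [2 * k] are joined;
   a rung joins the antipodal positions [g] and [2 * k + g]. *)
Definition ladder (s : nat -> V) :=
  [/\ forall i, s (i + 4 * k) = s i, forall i, e (s i) (s i.+1) & e (s 0) (s (2 * k))].

Lemma ladder_swap s : ladder s -> ladder (fun i => s (2 * k + i)).
Proof.
case=> per st r0; split=> [i|i|]; first by rewrite addnA per.
- by rewrite addnS; apply: st.
- have -> : 2 * k + 2 * k = 0 + 4 * k by lia.
  by rewrite per addn0 e_sym.
Qed.

Section Constraints.
Variables (s : nat -> V) (Ls : ladder s).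

Lemma lad_seg i j : i <= j -> wlk e (j - i) (s i) (s j).
Proof. by case: Ls => _ st _ ij; apply: (@wlk_fun _ e s j). Qed.

Lemma lad_rung : wlk e 1 (s 0) (s (2 * k)).
Proof. by rewrite wlk1; case: Ls. Qed.

Lemma lad_back j : j <= 2 * k -> wlk e (2 * k - j) (s (2 * k + j)) (s 0).
Proof.
move=> j2; have := @lad_seg (2 * k + j) (0 + 4 * k) ltac:(lia).
by case: Ls => -> _ _; congr wlk; lia.
Qed.

Variable z : V.

(** A rail, the next vertex [s (2 * k)] and the rung at 0 form a closed walk of length 2k+1. *)
Lemma lad_uu i i' : i < i' -> i' < 2 * k -> e z (s i) -> e z (s i') ->
  i' = i + 2 \/ i = 0 /\ i' = 2 * k - 1.
Proof.
move=> ii ik zi zi'; have w1 := lad_seg (ltnW ii).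
have w2 := wlk_cat (wlk_cat (lad_seg (ltnW ik)) (wlk_sym e_sym lad_rung)) (lad_seg (leq0n i)).
have := see e_sym og zi zi' w1; have := see e_sym og zi' zi w2; clear -ii ik k3; lia.
Qed.

Lemma lad_uc_ne i j : i < 2 * k -> j < 2 * k -> e z (s i) -> e z (s (2 * k + j)) ->
  odd (i + j) -> i = j.+1 \/ j = i.+1.
Proof.
move=> ik jk zi zj o.
have wb := wlk_cat (lad_seg (ltnW ik)) (@lad_seg (2 * k) (2 * k + j) (leq_addr _ _)).
have wc := wlk_cat (lad_back (ltnW jk)) (lad_seg (leq0n i)).
have h1 := see e_sym og zi zj wb; have h2 := see e_sym og zj zi wc.
clear -h1 h2 ik jk k3 o; lia.
Qed.

Lemma lad_uc_eq i j : i < 2 * k -> j < 2 * k -> e z (s i) -> e z (s (2 * k + j)) ->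
  ~~ odd (i + j) -> 2 * k - 2 <= i + j <= 2 * k + 2.
Proof.
move=> ik jk zi zj o.
have wa := wlk_cat (wlk_cat (wlk_sym e_sym (lad_seg (leq0n i))) lad_rung) (@lad_seg (2 * k) (2 * k + j) (leq_addr _ _)).
have we := wlk_cat (wlk_cat (lad_seg (ltnW ik)) (wlk_sym e_sym lad_rung)) (wlk_sym e_sym (lad_back (ltnW jk))).
have h3 := see e_sym og zi zj wa; have h4 := see e_sym og zi zj we.
clear -h3 h4 ik jk k3 o; lia.
Qed.

Lemma lad_uc_rung g i j : e z (s i) -> e z (s (2 * k + j)) -> e (s g) (s (2 * k + g)) ->
  ~~ odd (i + j) -> 2 * k - 2 <= (i - g) + (g - i) + ((j - g) + (g - j)).
Proof.
move=> zi zj; rewrite -wlk1 => rg o.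
have seg2 a b : exists2 d, wlk e d (s a) (s b) & d = (a - b) + (b - a).
  have [ab|/ltnW ba] := leqP a b.
    by exists (b - a); [apply: lad_seg | lia].
  by exists (a - b); [apply: (wlk_sym e_sym); apply: lad_seg | lia].
have [d1 w1 e1] := seg2 i g; have [d2 w2 e2] := seg2 (2 * k + g) (2 * k + j).
have h := see e_sym og zi zj (wlk_cat (wlk_cat w1 rg) w2).
clear -h e1 e2 o k3; lia.
Qed.

Section Detour.
Variables (q : nat -> V).
Hypotheses (q0 : q 0 = s 1) (qe : q (2 * k - 2) = s (2 * k + 1)).
Hypothesis qs : forall t, t < 2 * k - 2 -> e (q t) (q t.+1).

Lemma lad_qs a b : a <= b -> b <= 2 * k - 2 -> wlk e (b - a) (q a) (q b).
Proof. exact: (wlk_fun qs). Qed.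

Let w10 : wlk e 1 (s 1) (s 0).
Proof. by rewrite wlk1 e_sym; case: Ls. Qed.

Let w2k : wlk e 1 (s (2 * k + 1)) (s (2 * k)).
Proof. by rewrite wlk1 e_sym addn1; case: Ls. Qed.

Lemma lad_qu_eq t i : t <= 2 * k - 2 -> i < 2 * k -> e z (q t) -> e z (s i) -> ~~ odd (t + i) ->
  t + i = 2 * k \/ i = 0 /\ t = 2 * k - 2.
Proof.
move=> tk ik zt zi o.
have back := wlk_sym e_sym (lad_qs (leq0n t) tk); rewrite q0 in back.
have fwd := lad_qs tk (leqnn _); rewrite qe in fwd.
have h2 := see e_sym og zt zi (wlk_cat (wlk_cat fwd w2k) (wlk_sym e_sym (lad_seg (ltnW ik)))).
have [i0|ipos] := posnP i.
  rewrite i0 in zi *; have h := see e_sym og zt zi (wlk_cat back w10).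
  clear -h i0 o tk k3; lia.
have h := see e_sym og zt zi (wlk_cat back (lad_seg ipos)).
clear -h h2 o tk k3 ipos ik; lia.
Qed.

Lemma lad_qu_ne t i : t <= 2 * k - 2 -> i < 2 * k -> e z (q t) -> e z (s i) -> odd (t + i) ->
  t <= i + 1 /\ i <= t + 3.
Proof.
move=> tk ik zt zi o.
have back := wlk_sym e_sym (lad_qs (leq0n t) tk); rewrite q0 in back.
have fwd := lad_qs tk (leqnn _); rewrite qe in fwd.
have h1 := see e_sym og zt zi (wlk_cat (wlk_cat (wlk_cat fwd w2k) (wlk_sym e_sym lad_rung)) (lad_seg (leq0n i))).
have h2 := see e_sym og zt zi (wlk_cat (wlk_cat (wlk_cat back w10) lad_rung) (wlk_sym e_sym (lad_seg (ltnW ik)))).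
clear -h1 h2 o tk k3 ik; lia.
Qed.

Lemma lad_qq t t' : t < t' -> t' <= 2 * k - 2 -> e z (q t) -> e z (q t') -> t' = t + 2.
Proof.
move=> tt tk zt zt'.
have tk' : t <= 2 * k - 2 by apply: leq_trans (ltnW tt) tk.
have back := wlk_sym e_sym (lad_qs (leq0n t) tk'); rewrite q0 in back.
have fwd := wlk_sym e_sym (lad_qs tk (leqnn _)); rewrite qe in fwd.
have h1 := see e_sym og zt zt' (lad_qs (ltnW tt) tk).
have h2 := see e_sym og zt zt' (wlk_cat (wlk_cat (wlk_cat (wlk_cat back w10) lad_rung) (wlk_sym e_sym w2k)) fwd).
clear -h1 h2 tt tk k3; lia.
Qed.

End Detour.

End Constraints.

(* Otherwise saturation gives a walk of length [2 * k - 2] between the two ends;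
   together with the ladder it is a list of [6 * k - 1] vertices in which no vertex
   has more than four neighbours. *)
Lemma ladder_rung1 s g : ladder s -> 3 <= g <= 2 * k - 3 -> e (s g) (s (2 * k + g)) -> e (s 1) (s (2 * k + 1)).
Proof.
move=> Ls gk rg; have [//|nr] := boolP (e (s 1) (s (2 * k + 1))).
have [q [q0 qe qs]] := wlk_funP (sat nr).
have Ls' := ladder_swap Ls; set s' := (fun i => _) in Ls'.
have per i : s (i + 4 * k) = s i by case: Ls.
(* The detour reversed starts at position 1 of the swapped ladder, so the constraints against the
   second rail follow from those against the first. *)
pose q' t := q (2 * k - 2 - t).
have q0' : q' 0 = s' 1 by rewrite /q' subn0 qe.
have qe' : q' (2 * k - 2) = s' (2 * k + 1).
  by rewrite /q' subnn q0 /s' -(per 1); congr s; lia.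
have qs' t : t < 2 * k - 2 -> e (q' t) (q' t.+1).
  move=> tk; rewrite /q' e_sym; have -> : 2 * k - 2 - t = (2 * k - 2 - t.+1).+1 by lia.
  by apply: qs; lia.
pose L := [seq s i | i <- iota 0 (2 * k)] ++ [seq s' j | j <- iota 0 (2 * k)] ++ [seq q t | t <- iota 0 (2 * k - 1)].
have sL : size L = 6 * k - 1 by rewrite !size_cat !size_map !size_iota; clear -k3; lia.
suff cL z : count (e z) L <= 4.
  by have := dense_count e_sym dns (_ : L != [::]) cL; rewrite -size_eq0 sL ltnn => h; apply: h; clear -k3; lia.
rewrite !count_cat !count_map.
set cu := count _ (iota 0 (2 * k)); set cc := count _ (iota 0 (2 * k)); set cq := count _ _.
have uu i i' : i < i' -> i' < 2 * k -> e z (s i) -> e z (s i') -> rail_gap k i i' by exact: (lad_uu Ls).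
have vv i i' : i < i' -> i' < 2 * k -> e z (s' i) -> e z (s' i') -> rail_gap k i i' by exact: (lad_uu Ls').
have cu2 : cu <= 2.
  by apply: count_le2 => a b c ab bc cm za zb zc; have := uu a b ab (ltn_trans bc cm) za zb;
   have := uu b c bc cm zb zc; have := uu a c (ltn_trans ab bc) cm za zc; rewrite /rail_gap; clear -ab bc cm k3; lia.
have cc2 : cc <= 2.
  by apply: count_le2 => a b c ab bc cm za zb zc; have := vv a b ab (ltn_trans bc cm) za zb;
   have := vv b c bc cm zb zc; have := vv a c (ltn_trans ab bc) cm za zc; rewrite /rail_gap; clear -ab bc cm k3; lia.
have qq t t' : t < t' -> t' < 2 * k - 1 -> e z (q t) -> e z (q t') -> t' = t + 2.
  by move=> tt tk zt zt'; apply: (lad_qq Ls q0 qe qs tt _ zt zt'); clear -tk; lia.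
have cq2 : cq <= 2.
  by apply: count_le2 => a b c ab bc cm za zb zc; have := qq a b ab (ltn_trans bc cm) za zb;
   have := qq b c bc cm zb zc; have := qq a c (ltn_trans ab bc) cm za zc; clear -ab bc cm k3; lia.
have uq t i : t < 2 * k - 1 -> i < 2 * k -> e z (q t) -> e z (s i) -> detour_gap k t i.
  move=> tk ik zt zi; have tk' : t <= 2 * k - 2 by clear -tk; lia.
  rewrite /detour_gap; case: ifP => o; first exact: (lad_qu_ne Ls q0 qe qs tk' ik zt zi o).
  exact: (lad_qu_eq Ls q0 qe qs tk' ik zt zi (negbT o)).
have vq t i : t < 2 * k - 1 -> i < 2 * k -> e z (q t) -> e z (s' i) -> detour_opp_gap k t i.
  move=> tk ik zt zi; have tk' : 2 * k - 2 - t <= 2 * k - 2 by clear -tk; lia.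
  have zt' : e z (q' (2 * k - 2 - t)).
    by rewrite /q'; have -> : 2 * k - 2 - (2 * k - 2 - t) = t by clear -tk; lia.
  rewrite /detour_opp_gap; case: ifP => o.
    have := lad_qu_ne Ls' q0' qe' qs' tk' ik zt' zi; clear -o tk; lia.
  have := lad_qu_eq Ls' q0' qe' qs' tk' ik zt' zi; clear -o tk; lia.
have uv i j : i < 2 * k -> j < 2 * k -> e z (s i) -> e z (s' j) -> rails_gap k g i j.
  move=> ik jk zi zj; rewrite /rails_gap; case: ifP => o; first exact: (lad_uc_ne Ls ik jk zi zj o).
  split; first exact: (lad_uc_eq Ls ik jk zi zj (negbT o)).
  exact: (lad_uc_rung Ls zi zj rg (negbT o)).
have [//|c5] := leqP (cu + (cc + cq)) 4.
have [u1 [v1 q1]] : 0 < cu /\ 0 < cc /\ 0 < cq by clear -c5 cu2 cc2 cq2; lia.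
have [[cu2' cc2']|[[cu2' cq2']|[cc2' cq2']]] : 1 < cu /\ 1 < cc \/ 1 < cu /\ 1 < cq \/ 1 < cc /\ 1 < cq.
- by clear -c5 cu2 cc2 cq2; lia.
- have [i [i' [ii ik zi zi']]] := count2 cu2'; have [j [j' [jj jk zj zj']]] := count2 cc2'.
  have [t tk zt] := count1 q1; have ik' := ltn_trans ii ik; have jk' := ltn_trans jj jk.
  by case: (@crowded_rails k g k3 gk i i' j j' t); auto.
- have [i [i' [ii ik zi zi']]] := count2 cu2'; have [t [t' [tt tk zt zt']]] := count2 cq2'.
  have [j jk zj] := count1 v1; have ik' := ltn_trans ii ik; have tk' := ltn_trans tt tk.
  by case: (@crowded_detour k g k3 gk i i' j t t'); auto.
- have [j [j' [jj jk zj zj']]] := count2 cc2'; have [t [t' [tt tk zt zt']]] := count2 cq2'.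
  have [i ik zi] := count1 u1; have jk' := ltn_trans jj jk; have tk' := ltn_trans tt tk.
  by case: (@crowded_detour_opp k g k3 gk i j j' t t'); auto.
Qed.

Lemma ladder_shift s a : ladder s -> e (s a) (s (2 * k + a)) -> ladder (fun i => s (a + i)).
Proof.
case=> per st r0 ra; split=> [i|i|]; first by rewrite addnA per.
- by rewrite addnS; apply: st.
- by rewrite addn0 [a + _]addnC.
Qed.

Lemma periodic_mul (f : nat -> V) m i j : (forall i, f (i + m) = f i) -> f (i + j * m) = f i.
Proof. by move=> per; elim: j => [|j IH]; rewrite ?addn0 // mulSn addnCA addnC per. Qed.

(** The factor 4k-1 is -1 modulo 4k, which reverses the walk without subtraction on naturals. *)
Lemma ladder_rev s : ladder s -> ladder (fun i => s ((4 * k - 1) * i)).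
Proof.
case=> per st r0; split=> [i|i|].
- by rewrite mulnDr (periodic_mul _ _ per).
- rewrite e_sym mulnS.
  have := st (4 * k - 1 + (4 * k - 1) * i); have -> : (4 * k - 1 + (4 * k - 1) * i).+1 = (4 * k - 1) * i + 4 * k.
    by clear -k3; lia.
  by rewrite per.
- rewrite muln0; have -> : (4 * k - 1) * (2 * k) = 2 * k + (2 * k - 1) * (4 * k) by clear -k3; nia.
  by rewrite (periodic_mul _ _ per).
Qed.

(** For g >= 4, shift by the new rung at 1 and apply [ladder_rung1] again. For g = 3 the shifted [g]
    would be too small, so the ladder is read backwards from 3: the old rung at 0 becomes the rung
    at 3, and the rung obtained at 1 is the old position 2. *)
Lemma ladder_rung2 s g : ladder s -> 3 <= g <= 2 * k - 3 -> e (s g) (s (2 * k + g)) -> e (s 2) (s (2 * k + 2)).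
Proof.
move=> Ls gk rg; have [g4|g3] : 4 <= g \/ g = 3 by clear -gk; lia.
  have r1 := ladder_rung1 Ls gk rg; have Ls1 := ladder_shift Ls r1.
  have := @ladder_rung1 _ (g - 1) Ls1; rewrite [1 + (2 * k + (g - 1))]addnCA subnKC; last by clear -g4; lia.
  by rewrite addnCA => /(_ _ rg); apply; clear -g4 gk; lia.
rewrite {}g3 in rg gk; have Ls3 := ladder_rev (ladder_shift Ls rg).
have per i : s (i + 4 * k) = s i by case: Ls.
have := ladder_rung1 Ls3 gk => /=.
have -> : s (3 + (4 * k - 1) * 3) = s 0.
  have -> : 3 + (4 * k - 1) * 3 = 0 + 3 * (4 * k) by clear -k3; lia.
  by rewrite (periodic_mul _ _ per).
have -> : s (3 + (4 * k - 1) * (2 * k + 3)) = s (2 * k).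
  have -> : 3 + (4 * k - 1) * (2 * k + 3) = 2 * k + (2 * k + 2) * (4 * k) by clear -k3; nia.
  by rewrite (periodic_mul _ _ per).
have -> : s (3 + (4 * k - 1) * 1) = s 2.
  have -> : 3 + (4 * k - 1) * 1 = 2 + 1 * (4 * k) by clear -k3; lia.
  by rewrite (periodic_mul _ _ per).
have -> : s (3 + (4 * k - 1) * (2 * k + 1)) = s (2 * k + 2).
  have -> : 3 + (4 * k - 1) * (2 * k + 1) = (2 * k + 2) + (2 * k) * (4 * k) by clear -k3; nia.
  by rewrite (periodic_mul _ _ per).
by case: (Ls) => _ _ r0; apply.
Qed.

End Ladder.

(** * Closed walks of length 2k+1 *)

Section EscapePositions.
Variables (k : nat).
Hypotheses (k3 : 2 < k).
Definition cycle_gap p p' := p' = p + 2 \/ p' = p + (2 * k - 1).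
Definition escape_gap i p := if odd (i + p) then 2 * k - 3 <= i + p <= 2 * k - 1 else i <= p <= i + 4.
Definition escape_opp_gap j p := (p = 0 /\ escape_gap j 0) \/
  (0 < p /\ if odd (j + p) then j + p <= 2 * k + 1 <= j + p + 4 else j + 2 <= p <= j + 4).
Definition escapes_gap i j := if odd (i + j) then i + j = 2 * k - 1 else i <= j + 2 /\ j <= i + 2.

(** Unlike on a ladder, five neighbours are possible here; the surviving positions are those that
    [shortcut] describes, up to mirroring. *)
Lemma crowded_cycle p p' i i' j : p < p' -> p' <= 2 * k -> i' <= 2 * k - 2 -> j <= 2 * k - 2 ->
  cycle_gap p p' -> i' = i + 2 -> escape_gap i p -> escape_gap i p' -> escape_gap i' p -> escape_gap i' p' -> escape_opp_gap j p -> escape_opp_gap j p' ->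
  escapes_gap i j -> escapes_gap i' j ->
  [\/ p' = p + 2 /\ p' = j + 4, p' = p + 2 /\ 0 < p /\ (p' + i = 2 * k - 1 \/ p' + i' = 2 * k - 1),
   0 < p /\ p + i = 2 * k - 3 \/ p' + i = 2 * k - 3 | [/\ p = 1, p' = 2 * k & i = 2 * k - 4 \/ i' = 2 * k - 4 \/ j = 2 * k - 4]].
Proof.
move=> pp pk ik jk; case=> pe ie; subst p' i'; rewrite /escape_opp_gap /escape_gap /escapes_gap ?addn0 !oddD /= => h1 h2 h3 h4 h5 h6 h7 h8.
- suff : (p + 2 = j + 4 \/ (0 < p /\ (p + 2 + i = 2 * k - 1 \/ p + 2 + (i + 2) = 2 * k - 1)) \/ (0 < p /\ p + i = 2 * k - 3 \/ p + 2 + i = 2 * k - 3)).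
    case=> [h|[[h h']|h]]; [apply: Or41|apply: Or42|apply: Or43] => //.
  move: h1 h2 h3 h4 h5 h6 h7 h8.
  case: (odd p); case: (odd i); case: (odd j) => /= h1 h2 h3 h4 h5 h6 h7 h8; lia.
- suff : ((0 < p /\ p + i = 2 * k - 3 \/ p + (2 * k - 1) + i = 2 * k - 3) \/ [/\ p = 1, p + (2 * k - 1) = 2 * k & i = 2 * k - 4 \/ i + 2 = 2 * k - 4 \/ j = 2 * k - 4]).
    by case=> h; [apply: Or43|apply: Or44].
  have od : odd (2 * k - 1) by clear -k3; lia.
  rewrite od in h2 h4 h6; have [p0|p1] : p = 0 \/ p = 1 by clear -pk; lia.
    subst p; move: h1 h2 h3 h4 h5 h6 h7 h8.
    case: (odd i); case: (odd j) => /= h1 h2 h3 h4 h5 h6 h7 h8; lia.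
  subst p; move: h1 h2 h3 h4 h5 h6 h7 h8.
  case: (odd i); case: (odd j) => /= h1 h2 h3 h4 h5 h6 h7 h8; lia.
Qed.

Lemma crowded_escapes p i i' j j' : p <= 2 * k -> i' <= 2 * k - 2 -> j' <= 2 * k - 2 ->
  i' = i + 2 -> j' = j + 2 -> escape_gap i p -> escape_gap i' p -> escape_opp_gap j p -> escape_opp_gap j' p ->
  escapes_gap i j -> escapes_gap i' j -> escapes_gap i j' -> escapes_gap i' j' ->
  p = j + 4 \/ p + i = 2 * k - 3 /\ 0 < p.
Proof.
move=> pk ik jk ie je; subst i' j'; rewrite /escape_opp_gap /escape_gap /escapes_gap ?addn0 !oddD /=.
case: (odd p); case: (odd i); case: (odd j) => /= h1 h2 h3 h4 h5 h6 h7 h8; lia.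
Qed.
End EscapePositions.

Section Dom.
Variables (V : finType) (e : rel V) (k : nat).
Hypotheses (k3 : 2 < k) (e_sym : symmetric e) (og : no_short_odd e k).
Hypotheses (dns : dense e k) (sat : saturated e k).
Implicit Types (x u w : nat -> V).

Definition cyc x := (forall i, x (i + (2 * k + 1)) = x i) /\ (forall i, e (x i) (x i.+1)).

(* The walk [x] run backwards, since [2 * k] is [-1] modulo [2 * k + 1]. *)
Definition mirror x i := x (2 * k * i).

Lemma mirrorE x p : cyc x -> p <= 2 * k + 1 -> mirror x p = x (2 * k + 1 - p).
Proof.
case=> per _ pk; rewrite /mirror; have [p0|p0] := posnP p.
  by rewrite p0 muln0 subn0 -(per 0).
have -> : 2 * k * p = (2 * k + 1 - p) + (p - 1) * (2 * k + 1) by clear -pk p0; nia.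
exact: periodic_mul.
Qed.

Lemma mirror_cyc x : cyc x -> cyc (mirror x).
Proof.
case=> per st; split=> i; rewrite /mirror; first by rewrite mulnDr (periodic_mul _ _ per).
rewrite e_sym mulnS -(per (2 * k * i)) addnA addn1 [2 * k + _]addnC; exact: st.
Qed.

Lemma mirrorK x p : cyc x -> mirror (mirror x) p = x p.
Proof.
case=> per _; rewrite /mirror; have -> : 2 * k * (2 * k * p) = p + (p * (2 * k - 1)) * (2 * k + 1).
  by clear -k3; nia.
exact: periodic_mul.
Qed.

Lemma cyc_shift x a : cyc x -> cyc (fun i => x (a + i)).
Proof. by case=> per st; split=> i; [rewrite addnA per | rewrite addnS; apply: st]. Qed.

Lemma cyc_seg x i j : cyc x -> i <= j -> wlk e (j - i) (x i) (x j).
Proof. by case=> _ st ij; apply: (@wlk_fun _ e x j). Qed.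

Lemma cyc_closed x : cyc x -> x (2 * k + 1) = x 0.
Proof. by case=> per _; rewrite -(per 0). Qed.

Lemma cyc_back x i : cyc x -> i <= 2 * k + 1 -> wlk e (2 * k + 1 - i) (x i) (x 0).
Proof. by move=> cx ik; rewrite -(cyc_closed cx); apply: cyc_seg. Qed.

Lemma cyc_pair x z p p' : cyc x -> p < p' -> p' <= p + 2 * k -> e z (x p) -> e z (x p') -> cycle_gap k p p'.
Proof.
move=> cx pp pk zp zp'; have w1 := cyc_seg cx (ltnW pp).
have w2 := @cyc_seg _ p' (p + (2 * k + 1)) cx ltac:(clear -pk; lia); rewrite (proj1 cx) in w2.
have h1 := see e_sym og zp zp' w1; have h2 := see e_sym og zp' zp w2.
clear -h1 h2 pp pk k3; rewrite /cycle_gap; lia.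
Qed.

Definition swap x p z i := if i %% (2 * k + 1) == p then z else x i.

Lemma swap_cyc x p z : cyc x -> p <= 2 * k -> e z (x (p + 2 * k)) -> e z (x (p + 1)) -> cyc (swap x p z).
Proof.
move=> cx pk zp zp2; have [per st] := cx.
split=> i; rewrite /swap; first by rewrite modnDr per.
have xm j c : x (j + c) = x (j %% (2 * k + 1) + c).
  by rewrite {1}(divn_eq j (2 * k + 1)) -addnA addnC (periodic_mul _ _ per) addnC.
case: eqP => [i1|_]; case: eqP => [i2|_]; last exact: st.
- have /eqP : 1 = 0 %[mod 2 * k + 1].
    by apply/eqP; rewrite -(eqn_modDl i) addn1 addn0 i1 i2.
  by rewrite mod0n modn_small; clear -k3; lia.
- by rewrite -addn1 xm i1.
- by rewrite e_sym -(per i) addn1 addnS -addSn xm i2.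
Qed.

Lemma swapE x p z i : i <= 2 * k -> swap x p z i = if i == p then z else x i.
Proof. by move=> ik; rewrite /swap modn_small // addn1. Qed.

(* [u] leaves [x 0] and comes back to [x 1]; together with [x] it forms a ladder. *)
Lemma no_rung x u g : cyc x -> u 0 = x 0 -> (forall i, i < 2 * k - 1 -> e (u i) (u i.+1)) ->
  e (u (2 * k - 1)) (x 1) -> ~~ e (u 2) (x 3) -> 3 <= g <= 2 * k - 3 -> ~~ e (u g) (x g.+1).
Proof.
move=> cx u0 us ux n23 gk; apply: contra n23 => rg.
(* The rails are u 0, ..., u (2k-1) and x 1, ..., x (2k). The base rung is the edge from x 0 to x 1,
   and the rung at g joins u g to x (g+1). *)
pose t r := if r < 2 * k then u r else x (r - 2 * k + 1).
pose s i := t (i %% (4 * k)).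
have k4 : 0 < 4 * k by clear -k3; lia.
have sE i : i < 4 * k -> s i = t i by move=> ik; rewrite /s modn_small.
have tu r : r < 2 * k -> t r = u r by rewrite /t => ->.
have tx r : t (2 * k + r) = x r.+1 by rewrite /t ltnNge leq_addr /= addKn addn1.
have Ls : ladder e k s.
  split=> [i|i|]; first by rewrite /s modnDr.
    rewrite /s -[i.+1]addn1 -modnDml; move: (ltn_pmod i k4); move: (i %% _) => r rk.
    have [r1|[r1|[r1|r1]]] : r < 2 * k - 1 \/ r = 2 * k - 1 \/ 2 * k <= r < 4 * k - 1 \/ r = 4 * k - 1.
    - by clear -rk; lia.
    - rewrite modn_small; last by clear -r1; lia.
      by rewrite !tu ?addn1 ?us //; clear -r1; lia.
    - rewrite modn_small; last by clear -r1 k3; lia.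
      rewrite tu; last by clear -r1 k3; lia.
      have -> : r + 1 = 2 * k + 0 by clear -r1 k3; lia.
      by rewrite tx r1.
    - rewrite modn_small; last by clear -r1; lia.
      have -> : r + 1 = 2 * k + (r - 2 * k).+1 by clear -r1; lia.
      have {1}-> : r = 2 * k + (r - 2 * k) by clear -r1; lia.
      by rewrite !tx; apply: (proj2 cx).
    have -> : r + 1 = 4 * k by clear -r1 k4; lia.
    have -> : r = 2 * k + (2 * k - 1) by clear -r1 k4; lia.
    rewrite modnn tx tu; last by clear -k3; lia.
    have := proj2 cx (2 * k); have -> : (2 * k).+1 = 2 * k + 1 by clear; lia.
    by rewrite (cyc_closed cx) u0; have -> : (2 * k - 1).+1 = 2 * k by clear -k3; lia.
  rewrite !sE; try by clear -k3; lia.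
  rewrite tu; last by clear -k3; lia.
  by rewrite -[2 * k]addn0 tx u0; apply: (proj2 cx).
have rg' : e (s g) (s (2 * k + g)).
  rewrite !sE; try by clear -gk; lia.
  by rewrite tu ?tx //; clear -gk; lia.
have := ladder_rung2 k3 e_sym og dns sat Ls gk rg'.
rewrite !sE; try by clear -k3; lia.
by rewrite tx tu //; clear -k3; lia.
Qed.

End Dom.

(** * Escapes from an undominated vertex *)

Section Escape.
Variables (V : finType) (e : rel V) (k : nat).
Hypotheses (k3 : 2 < k) (e_sym : symmetric e) (og : no_short_odd e k).
Hypotheses (dns : dense e k) (sat : saturated e k).
Implicit Types (x u w : nat -> V).

(** Saturation provides such a walk when [v] is not adjacent to [x (2 * k)], the predecessor of
    [x 0]; for [mirror x] the end is the successor [x 1]. *)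
Definition escape x v w :=
  [/\ w 0 = v, w (2 * k - 2) = x (2 * k) & forall i, i < 2 * k - 2 -> e (w i) (w i.+1)].

Lemma esc_seg x v w i j : escape x v w -> i <= j -> j <= 2 * k - 2 -> wlk e (j - i) (w i) (w j).
Proof. by case=> _ _ st; apply: (wlk_fun st). Qed.

Lemma esc_last x v w i : escape x v w -> i <= 2 * k - 2 -> wlk e (2 * k - 2 - i) (w i) (x (2 * k)).
Proof. by move=> ew ik; have [_ <- _] := ew; apply: (esc_seg ew). Qed.

Lemma esc_first x v w i : escape x v w -> i <= 2 * k - 2 -> wlk e i (w i) v.
Proof.
move=> ew ik; have [<- _ _] := ew; apply: (wlk_sym e_sym).
by have := esc_seg ew (leq0n i) ik; rewrite subn0.
Qed.

Section Constraints.
Variables (x : nat -> V) (v y : V).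
Hypotheses (cx : cyc e k x) (vy : e v y) (yx : e y (x 0)).

Let hub : wlk e 2 v (x 0).
Proof. by apply: (wlkS vy); rewrite wlk1. Qed.

Let close : wlk e 1 (x (2 * k)) (x 0).
Proof. by rewrite wlk1 -(cyc_closed cx) addn1; apply: (proj2 cx). Qed.

(** From [w i] one reaches [x p] through the end of [w] or back through [v] and [y], and then along
    [x] in either direction; two of these four walks are odd. *)
Lemma esc_wx w z i p : escape x v w -> i <= 2 * k - 2 -> p <= 2 * k -> e z (w i) -> e z (x p) -> escape_gap k i p.
Proof.
move=> ew ik pk zi zp.
have to_last := esc_last ew ik; have to_v := wlk_cat (esc_first ew ik) hub.
rewrite /escape_gap; case: ifP => o.
  have h1 := see e_sym og zi zp (wlk_cat to_last (wlk_sym e_sym (cyc_seg cx pk))) ltac:(clear -o ik pk; lia).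
  have h2 := see e_sym og zi zp (wlk_cat to_v (cyc_seg cx (leq0n p))) ltac:(clear -o; lia).
  clear -h1 h2 ik pk k3; lia.
have h3 := see e_sym og zi zp (wlk_cat (wlk_cat to_last close) (cyc_seg cx (leq0n p))) ltac:(clear -o ik; lia).
have h4 := see e_sym og zi zp (wlk_cat (wlk_cat to_v (wlk_sym e_sym close)) (wlk_sym e_sym (cyc_seg cx pk))) ltac:(clear -o pk; lia).
clear -h3 h4 ik pk k3; lia.
Qed.

Lemma esc_ww w z i i' : escape x v w -> i < i' -> i' <= 2 * k - 2 -> e z (w i) -> e z (w i') -> i' = i + 2.
Proof.
move=> ew ii ik zi zi'; have ik' : i <= 2 * k - 2 by apply: leq_trans (ltnW ii) ik.
have h1 := see e_sym og zi zi' (esc_seg ew (ltnW ii) ik).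
have h2 := see e_sym og zi' zi (wlk_cat (wlk_cat (esc_last ew ik) close) (wlk_sym e_sym (wlk_cat (esc_first ew ik') hub))).
clear -h1 h2 ii ik k3; lia.
Qed.

End Constraints.

Lemma esc_cross x v y w w' z i j : cyc e k x -> e v y -> e y (x 0) -> escape x v w -> escape (mirror k x) v w' ->
  i <= 2 * k - 2 -> j <= 2 * k - 2 -> e z (w i) -> e z (w' j) -> escapes_gap k i j.
Proof.
move=> cx vy yx ew ew' ik jk zi zj.
have hub : wlk e 2 v (x 0) by apply: (wlkS vy); rewrite wlk1.
have close : wlk e 1 (x (2 * k)) (x 0) by rewrite wlk1 -(cyc_closed cx) addn1; apply: (proj2 cx).
have open : wlk e 1 (x 0) (x 1) by rewrite wlk1; apply: (proj2 cx).
have last' : wlk e (2 * k - 2 - j) (w' j) (x 1).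
  have := esc_last ew' jk; rewrite (mirrorE cx); last by clear; lia.
  by have -> : 2 * k + 1 - 2 * k = 1 by clear; lia.
rewrite /escapes_gap; case: ifP => o.
  have h1 := see e_sym og zi zj (wlk_cat (esc_first ew ik) (wlk_sym e_sym (esc_first ew' jk))) o.
  have h2 := see e_sym og zi zj (wlk_cat (wlk_cat (esc_last ew ik) (wlk_cat close open)) (wlk_sym e_sym last')) ltac:(clear -o ik jk; lia).
  clear -h1 h2 o ik jk k3; lia.
have h3 := see e_sym og zi zj (wlk_cat (wlk_cat (esc_first ew ik) (wlk_cat hub open)) (wlk_sym e_sym last')) ltac:(clear -o jk; lia).
have h4 := see e_sym og zj zi (wlk_cat (wlk_cat (esc_first ew' jk) (wlk_cat hub (wlk_sym e_sym close))) (wlk_sym e_sym (esc_last ew ik))) ltac:(clear -o ik; lia).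
clear -h3 h4 ik jk k3; lia.
Qed.

(** Exactly what is needed to reroute through [z] and gain a rung. With x 0, y put before w', the
    vertex [z] replaces the entry after w' (i+1) ... in the shifted numbering position i+3 of the
    loop, or it replaces x (i+3). In the last case it ends a loop built from [w]. *)
Definition shortcut x w w' z :=
  (exists i, [/\ i <= 2 * k - 4, e z (w' i), e z (x (i + 4)) & e z (w' (i + 2)) || e z (x (i + 2))]) \/
  [/\ e z (x 1), e z (x (2 * k)) & e z (w (2 * k - 4))].

Section Seen.
Variables (x w w' : nat -> V) (v y : V).
Hypotheses (cx : cyc e k x) (vy : e v y) (yx : e y (x 0)) (ew : escape x v w) (ew' : escape (mirror k x) v w').

Let cmx : cyc e k (mirror k x). Proof. exact: (mirror_cyc e_sym cx). Qed.
Let ymx : e y (mirror k x 0). Proof. by rewrite /mirror muln0. Qed.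

(** This is [esc_wx] on the mirrored walk, where p becomes 2k+1-p; position 0 is fixed and needs its
    own case. *)
Lemma esc_vx z j p : j <= 2 * k - 2 -> p <= 2 * k -> e z (w' j) -> e z (x p) -> escape_opp_gap k j p.
Proof.
move=> jk pk zj zp; have [p0|p0] := posnP p.
  left; split=> //; apply: (esc_wx cmx vy ymx ew' jk _ zj) => //.
  by rewrite /mirror muln0 -p0.
right; split=> //; have := @esc_wx _ v y cmx vy ymx w' z j (2 * k + 1 - p) ew' jk _ zj.
rewrite (mirrorE cx); last by clear; lia.
have -> : 2 * k + 1 - (2 * k + 1 - p) = p by clear -pk; lia.
move=> /(_ ltac:(clear -p0; lia) zp); rewrite /escape_gap.
have -> : odd (j + (2 * k + 1 - p)) = ~~ odd (j + p) by clear -pk; lia.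
by case: (odd (j + p)) => /=; clear -pk p0 k3; lia.
Qed.

Lemma seen_A z p p' i i' j : p < p' -> p' <= 2 * k -> i < i' -> i' <= 2 * k - 2 -> j <= 2 * k - 2 ->
  e z (x p) -> e z (x p') -> e z (w i) -> e z (w i') -> e z (w' j) ->
  shortcut x w w' z \/ shortcut (mirror k x) w' w z.
Proof.
move=> pp pk ii ik jk zp zp' zi zi' zj.
have pk' : p <= 2 * k by apply: leq_trans (ltnW pp) pk.
have ik' : i <= 2 * k - 2 by apply: leq_trans (ltnW ii) ik.
have ie := esc_ww cx vy yx ew ii ik zi zi'.
have mE q : q <= 2 * k + 1 -> mirror k x q = x (2 * k + 1 - q) by exact: (mirrorE cx).
have pe : cycle_gap k p p' by apply: (cyc_pair k3 e_sym og cx pp _ zp zp'); clear -pk; lia.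
have wx a q : a <= 2 * k - 2 -> q <= 2 * k -> e z (w a) -> e z (x q) -> escape_gap k a q by exact: (esc_wx cx vy yx ew).
have ww a b : a <= 2 * k - 2 -> b <= 2 * k - 2 -> e z (w a) -> e z (w' b) -> escapes_gap k a b.
  exact: (esc_cross cx vy yx ew ew').
have [] : [\/ p' = p + 2 /\ p' = j + 4, p' = p + 2 /\ 0 < p /\ (p' + i = 2 * k - 1 \/ p' + i' = 2 * k - 1),
   0 < p /\ p + i = 2 * k - 3 \/ p' + i = 2 * k - 3 | [/\ p = 1, p' = 2 * k & i = 2 * k - 4 \/ i' = 2 * k - 4 \/ j = 2 * k - 4]].
  have v1 := esc_vx jk pk' zj zp; have v2 := esc_vx jk pk zj zp'.
  by apply: (crowded_cycle k3 pp pk ik jk pe ie); auto.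
- case=> e1 e2; left; left; exists j; rewrite -e2 zj zp'; split=> //; first by clear -e2 pk; lia.
  have -> : j + 2 = p by clear -e1 e2; lia.
  by rewrite zp orbT.
- case=> e1 [p0 e2]; right; left.
  have [a [ea za ak]] : exists a, [/\ p' + a = 2 * k - 1, e z (w a) & a <= 2 * k - 4].
    by case: e2 => e2; [exists i|exists i']; split=> //; clear -e1 e2 p0; lia.
  exists a; rewrite za !mE; try by clear -ak k3; lia.
  have -> : 2 * k + 1 - (a + 4) = p by clear -ea e1 k3 ak; lia.
  have -> : 2 * k + 1 - (a + 2) = p' by clear -ea e1 k3 ak; lia.
  by rewrite zp zp' orbT.
- move=> e2; right; left.
  have [b [eb zb]] : exists b, b + i = 2 * k - 3 /\ e z (x b) by case: e2 => [[_ ?]|?]; [exists p|exists p'].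
  have ik4 : i <= 2 * k - 4 by clear -ik ie k3; lia.
  exists i; rewrite zi -ie zi' mE ; last by clear -ik4 k3; lia.
  by have -> : 2 * k + 1 - (i + 4) = b by clear -eb ik4 k3; lia.
- case=> p1 p2 a4; rewrite p1 in zp; rewrite p2 in zp'.
  case: a4 => [a4|[a4|a4]]; [left; right|left; right|right; right].
  + by split=> //; rewrite -a4.
  + by split=> //; rewrite -a4.
  rewrite !mE; try by clear -k3; lia.
  have -> : 2 * k + 1 - 1 = 2 * k by clear; lia.
  have -> : 2 * k + 1 - 2 * k = 1 by clear; lia.
  by split=> //; rewrite -a4.
Qed.

Lemma seen_B z p i i' j j' : p <= 2 * k -> i < i' -> i' <= 2 * k - 2 -> j < j' -> j' <= 2 * k - 2 ->
  e z (x p) -> e z (w i) -> e z (w i') -> e z (w' j) -> e z (w' j') ->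
  shortcut x w w' z \/ shortcut (mirror k x) w' w z.
Proof.
move=> pk ii ik jj jk zp zi zi' zj zj'.
have ik' : i <= 2 * k - 2 by apply: leq_trans (ltnW ii) ik.
have jk' : j <= 2 * k - 2 by apply: leq_trans (ltnW jj) jk.
have ie := esc_ww cx vy yx ew ii ik zi zi'.
have je := esc_ww cmx vy ymx ew' jj jk zj zj'.
have wx a q : a <= 2 * k - 2 -> q <= 2 * k -> e z (w a) -> e z (x q) -> escape_gap k a q by exact: (esc_wx cx vy yx ew).
have ww a b : a <= 2 * k - 2 -> b <= 2 * k - 2 -> e z (w a) -> e z (w' b) -> escapes_gap k a b.
  exact: (esc_cross cx vy yx ew ew').
have [e1|[e1 p0]] : p = j + 4 \/ p + i = 2 * k - 3 /\ 0 < p.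
  have v1 := esc_vx jk' pk zj zp; have v2 := esc_vx jk pk zj' zp.
  by apply: (crowded_escapes k3 pk ik jk ie je); auto.
- left; left; exists j; rewrite zj -e1 zp -je zj'; split=> //; clear -jk je k3; lia.
- right; left; exists i; have ik4 : i <= 2 * k - 4 by clear -ik ie k3; lia.
  rewrite zi -ie zi' (mirrorE cx); last by clear -ik4 k3; lia.
  by have -> : 2 * k + 1 - (i + 4) = p by clear -e1 ik4 k3; lia.
Qed.

End Seen.

Lemma shortcut_mirK x w w' z : cyc e k x -> shortcut (mirror k (mirror k x)) w w' z -> shortcut x w w' z.
Proof.
move=> cx; have mK p : mirror k (mirror k x) p = x p by exact: (mirrorK k3 _ cx).
by case=> [[i [h1 h2 h3 h4]]|[h1 h2 h3]]; [left; exists i; rewrite -!mK|right; rewrite -!mK].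
Qed.

(* The cycle and the two escapes form a list of [6 * k - 1] vertices, so some vertex
   has five neighbours in it. *)
Lemma escape_shortcut x v y w w' : cyc e k x -> e v y -> e y (x 0) -> escape x v w -> escape (mirror k x) v w' ->
  exists z, shortcut x w w' z \/ shortcut (mirror k x) w' w z.
Proof.
move=> cx vy yx ew ew'; have cmx := mirror_cyc e_sym cx.
have ymx : e y (mirror k x 0) by rewrite /mirror muln0.
have ewK : escape (mirror k (mirror k x)) v w by case: ew => h1 h2 h3; split=> //; rewrite (mirrorK k3 _ cx).
have mE q : q <= 2 * k + 1 -> mirror k x q = x (2 * k + 1 - q) by exact: (mirrorE cx).
pose L := [seq x p | p <- iota 0 (2 * k + 1)] ++ [seq w i | i <- iota 0 (2 * k - 1)] ++ [seq w' i | i <- iota 0 (2 * k - 1)].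
have sL : size L = 6 * k - 1 by rewrite !size_cat !size_map !size_iota; clear -k3; lia.
have [/existsP[z]|no] := boolP [exists z, 4 < count (e z) L]; last first.
  have cL z : count (e z) L <= 4 by rewrite leqNgt; move: no; rewrite negb_exists => /forallP.
  have := dense_count e_sym dns (_ : L != [::]) cL; rewrite -size_eq0 sL ltnn => h.
  by case: (notF (h _)); clear -k3; lia.
move=> c5; exists z; move: c5; rewrite !count_cat !count_map.
set cu := count _ (iota 0 (2 * k + 1)); set cc := count _ (iota 0 (2 * k - 1)); set cq := count _ (iota 0 (2 * k - 1)) => c5.
have xx i i' : i < i' -> i' < 2 * k + 1 -> e z (x i) -> e z (x i') -> cycle_gap k i i'.
  by move=> ii ik; apply: (cyc_pair k3 e_sym og cx ii); clear -ik; lia.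
have ww i i' : i < i' -> i' < 2 * k - 1 -> e z (w i) -> e z (w i') -> i' = i + 2.
  by move=> ii ik; apply: (esc_ww cx vy yx ew ii); clear -ik; lia.
have vv i i' : i < i' -> i' < 2 * k - 1 -> e z (w' i) -> e z (w' i') -> i' = i + 2.
  by move=> ii ik; apply: (esc_ww cmx vy ymx ew' ii); clear -ik; lia.
have cu2 : cu <= 2.
  by apply: count_le2 => a b c ab bc cm za zb zc; have := xx a b ab (ltn_trans bc cm) za zb;
   have := xx b c bc cm zb zc; have := xx a c (ltn_trans ab bc) cm za zc; rewrite /cycle_gap; clear -ab bc cm k3; lia.
have cc2 : cc <= 2.
  by apply: count_le2 => a b c ab bc cm za zb zc; have := ww a b ab (ltn_trans bc cm) za zb;
   have := ww b c bc cm zb zc; have := ww a c (ltn_trans ab bc) cm za zc; clear -ab bc cm k3; lia.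
have cq2 : cq <= 2.
  by apply: count_le2 => a b c ab bc cm za zb zc; have := vv a b ab (ltn_trans bc cm) za zb;
   have := vv b c bc cm zb zc; have := vv a c (ltn_trans ab bc) cm za zc; clear -ab bc cm k3; lia.
have w1 a : a < 2 * k - 1 -> a <= 2 * k - 2 by clear; lia.
have x1 a : a < 2 * k + 1 -> a <= 2 * k by clear; lia.
have [u1 [v1 q1]] : 0 < cu /\ 0 < cc /\ 0 < cq by clear -c5 cu2 cc2 cq2; lia.
have [[cu2' cc2']|[[cu2' cq2']|[cc2' cq2']]] : 1 < cu /\ 1 < cc \/ 1 < cu /\ 1 < cq \/ 1 < cc /\ 1 < cq.
- by clear -c5 cu2 cc2 cq2; lia.
- have [p [p' [pp pk zp zp']]] := count2 cu2'; have [i [i' [ii ik zi zi']]] := count2 cc2'.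
  have [j jk zj] := count1 q1.
  by apply: (@seen_A x w w' v y cx vy yx ew ew' z p p' i i' j); auto.
- have [p [p' [pp pk zp zp']]] := count2 cu2'; have [j [j' [jj jk zj zj']]] := count2 cq2'.
  have [i ik zi] := count1 v1.
  (* Two neighbours on the second escape are the situation of [seen_A] after mirroring, so the
     positions on the cycle are translated first. *)
  have [q [q' [qq qk zq zq']]] : exists q q', [/\ q < q', q' <= 2 * k, e z (mirror k x q) & e z (mirror k x q')].
    have [p0|p0] := posnP p.
      have z0 : e z (x 0) by move: zp; rewrite p0.
      have z1 : e z (mirror k x (2 * k + 1 - p')).
        by rewrite mE ?leq_subr //; have -> : 2 * k + 1 - (2 * k + 1 - p') = p' by clear -pk; lia.
      exists 0, (2 * k + 1 - p'); split=> //; first by clear -pk; lia.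
        by clear -pp p0; lia.
      by rewrite /mirror muln0.
    exists (2 * k + 1 - p'), (2 * k + 1 - p); split.
    - by clear -pp pk; lia.
    - by clear -p0; lia.
    - by rewrite mE ?leq_subr //; have -> : 2 * k + 1 - (2 * k + 1 - p') = p' by clear -pk; lia.
    - by rewrite mE ?leq_subr //; have -> : 2 * k + 1 - (2 * k + 1 - p) = p by clear -pk pp; lia.
  have [] := @seen_A (mirror k x) w' w v y cmx vy ymx ew' ewK z q q' j j' i; auto.
  by move/(shortcut_mirK cx); left.
- have [i [i' [ii ik zi zi']]] := count2 cc2'; have [j [j' [jj jk zj zj']]] := count2 cq2'.
  have [p pk zp] := count1 u1.
  by apply: (@seen_B x w w' v y cx vy yx ew ew' z p i i' j j'); auto.
Qed.

End Escape.

(** * Excluding undominated vertices *)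

Section Undominated.
Variables (V : finType) (e : rel V) (k : nat).
Hypotheses (k3 : 2 < k) (e_sym : symmetric e) (og : no_short_odd e k).
Hypotheses (dns : dense e k) (sat : saturated e k).
Implicit Types (x u w : nat -> V).

(** Closed by x 1 and x 0, [u] is a second closed walk of length 2k+1 sharing that edge with [x];
    the two together form a ladder. *)
Definition loop x u :=
  [/\ u 0 = x 0, forall i, i < 2 * k - 1 -> e (u i) (u i.+1) & e (u (2 * k - 1)) (x 1)].

Lemma loop_rung x u g : cyc e k x -> loop x u -> ~~ e (u 2) (x 3) -> 3 <= g <= 2 * k - 3 -> ~~ e (u g) (x g.+1).
Proof. by move=> cx [u0 us u1] n23 gk; apply: (no_rung k3 e_sym og dns sat cx u0). Qed.

Lemma loop_seg x u i j : loop x u -> i <= j -> j < 2 * k -> wlk e (j - i) (u i) (u j).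
Proof.
by case=> _ us _ ij jk; apply: (wlk_fun us ij); clear -jk; lia.
Qed.

Lemma loop_first x u t : loop x u -> t < 2 * k -> wlk e t (u t) (x 0).
Proof.
move=> lu tk; case: (lu) => <- _ _; apply: (wlk_sym e_sym).
by have := loop_seg lu (leq0n t) tk; rewrite subn0.
Qed.

Lemma loop_last x u t : loop x u -> t < 2 * k -> wlk e (2 * k - 1 - t + 1) (u t) (x 1).
Proof.
move=> lu tk; case: (lu) => _ _; rewrite -wlk1 => ul; apply: wlk_cat ul.
by apply: (loop_seg lu); clear -tk; lia.
Qed.

Lemma loop_see x u z t p : cyc e k x -> loop x u -> 3 <= t < 2 * k - 2 -> p <= 2 * k ->
  e z (u t) -> e z (x p) -> if odd (t + p) then is_true (2 * k - 1 <= t + p) else p = t \/ p = t + 2.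
Proof.
move=> cx lu tk pk zt zp; have tk' : t < 2 * k by clear -tk; lia.
have pk' : p <= 2 * k + 1 by clear -pk; lia.
have h1 := see e_sym og zt zp (wlk_cat (loop_first lu tk') (cyc_seg cx (leq0n p))).
have h2 := see e_sym og zt zp (wlk_cat (loop_first lu tk') (wlk_sym e_sym (cyc_back cx pk'))).
case: ifP => o; first by clear -h1 o; lia.
have [p0|p0] := posnP p.
  have w10 := wlk_sym e_sym (cyc_seg cx (leq0n 1)).
  rewrite p0 in zp; have h3 := see e_sym og zt zp (wlk_cat (loop_last lu tk') w10).
  clear -h3 o tk k3 p0; lia.
have h3 := see e_sym og zt zp (wlk_cat (loop_last lu tk') (cyc_seg cx p0)).
clear -h2 h3 o tk pk p0; lia.
Qed.

Lemma loop_uu x u z t t' : cyc e k x -> loop x u -> t < t' -> t' < 2 * k - 1 -> e z (u t) -> e z (u t') -> t' = t + 2.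
Proof.
move=> cx lu tt tk zt zt'; have tk' : t' < 2 * k by clear -tk; lia.
have w10 := wlk_sym e_sym (cyc_seg cx (leq0n 1)).
have h1 := see e_sym og zt zt' (loop_seg lu (ltnW tt) tk').
have h2 := see e_sym og zt' zt (wlk_cat (wlk_cat (loop_last lu tk') w10) (wlk_sym e_sym (loop_first lu (ltn_trans tt tk')))).
clear -h1 h2 tt tk k3; lia.
Qed.

(** Replacing x (t+1) by [z] would create a rung at t; t >= 3 keeps x 3 in place. *)
Lemma no_cycle_twin x u z t : cyc e k x -> loop x u -> ~~ e (u 2) (x 3) -> 3 <= t <= 2 * k - 3 ->
  e z (u t) -> e z (x t) -> e z (x (t + 2)) -> False.
Proof.
move=> cx lu n23 tk zt zx zx2.
have cx' : cyc e k (swap k x t.+1 z).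
  apply: (swap_cyc k3 e_sym cx); first by clear -tk; lia.
    have -> : t.+1 + 2 * k = t + (2 * k + 1) by clear; lia.
    by rewrite (proj1 cx).
  by have -> : t.+1 + 1 = t + 2 by clear; lia.
have sE i : i <= 2 * k -> swap k x t.+1 z i = if i == t.+1 then z else x i by exact: swapE.
have lu' : loop (swap k x t.+1 z) u.
  case: lu => u0 us u1; split=> //; first by rewrite sE.
  rewrite sE; last by clear -k3; lia.
  by have -> : (1 == t.+1) = false by clear -tk; lia.
have n : ~~ e (u 2) (swap k x t.+1 z 3).
  rewrite sE; last by clear -k3; lia.
  by have -> : (3 == t.+1) = false by clear -tk; lia.
have := loop_rung cx' lu' n tk; rewrite sE; last by clear -tk; lia.
by rewrite eqxx e_sym zt.
Qed.

(** Replacing u (t+1) by [z] would create a rung at t+1; t >= 2 keeps u 2 in place. *)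
Lemma no_loop_twin x u z t : cyc e k x -> loop x u -> ~~ e (u 2) (x 3) -> 2 <= t <= 2 * k - 4 ->
  e z (u t) -> e z (u (t + 2)) -> e z (x (t + 2)) -> False.
Proof.
move=> cx [u0 us u1] n23 tk zt zt2 zx.
pose u' i := if i == t.+1 then z else u i.
have lu : loop x u'.
  rewrite /u'; split=> [|i ik|].
  - by rewrite u0.
  - case: eqP => [it|_]; case: eqP => [it'|_]; last exact: us.
    + by clear -it it'; lia.
    + by rewrite it -addn2.
    + have -> : i = t by clear -it'; lia.
      by rewrite e_sym.
  - by have -> : (2 * k - 1 == t.+1) = false by clear -tk; lia.
have := @loop_rung _ u' t.+1 cx lu; rewrite /u' eqxx; have -> : (2 == t.+1) = false by clear -tk; lia.
have -> : t.+2 = t + 2 by clear; lia.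
by rewrite zx => /(_ n23) h; apply: notF; apply: h; clear -tk; lia.
Qed.

(** The cycle and the inner part of [u] form a list of 4k-4 entries. A vertex with three neighbours
    in it would be a twin of an entry, on [x] or after mirroring, so m = 2, which contradicts the
    count for k >= 4. *)
Lemma two_loops x u u' : 3 < k -> cyc e k x -> loop x u -> loop (mirror k x) u' ->
  (forall i, i <= 2 * k - 2 -> u' i = u i) -> ~~ e (u 2) (x 3) -> ~~ e (u 2) (mirror k x 3) -> False.
Proof.
move=> k4 cx lu lu' uu n23 n23'; have cmx := mirror_cyc e_sym cx.
have uuE i : i <= 2 * k - 2 -> u' i = u i by exact: uu.
have n23m : ~~ e (u' 2) (mirror k x 3) by rewrite uuE //; clear -k3; lia.
pose L := [seq x p | p <- iota 0 (2 * k + 1)] ++ [seq u (3 + i) | i <- iota 0 (2 * k - 5)].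
have sL : size L = 4 * k - 4 by rewrite size_cat !size_map !size_iota; clear -k4; lia.
suff cL z : count (e z) L <= 2.
  have := dense_count e_sym dns (_ : L != [::]) cL; rewrite -size_eq0 sL => h.
  by have {}h := h ltac:(clear -k4; lia); clear -h k4; lia.
rewrite count_cat !count_map.
set cx' := count _ (iota 0 (2 * k + 1)); set cu := count _ (iota 0 (2 * k - 5)).
have xx i i' : i < i' -> i' < 2 * k + 1 -> e z (x i) -> e z (x i') -> cycle_gap k i i'.
  by move=> ii ik; apply: (cyc_pair k3 e_sym og cx ii); clear -ik; lia.
have vv i i' : i < i' -> i' < 2 * k - 5 -> e z (u (3 + i)) -> e z (u (3 + i')) -> i' = i + 2.
  move=> ii ik zi zi'; suff : 3 + i' = 3 + i + 2 by clear; lia.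
  by apply: (loop_uu cx lu _ _ zi zi'); clear -ii ik; lia.
have cx2 : cx' <= 2.
  by apply: count_le2 => a b c ab bc cm za zb zc; have := xx a b ab (ltn_trans bc cm) za zb;
   have := xx b c bc cm zb zc; have := xx a c (ltn_trans ab bc) cm za zc; rewrite /cycle_gap; clear -ab bc cm k3; lia.
have cu2 : cu <= 2.
  by apply: count_le2 => a b c ab bc cm za zb zc; have := vv a b ab (ltn_trans bc cm) za zb;
   have := vv b c bc cm zb zc; have := vv a c (ltn_trans ab bc) cm za zc; clear -ab bc cm k3; lia.
have mE q : q <= 2 * k + 1 -> mirror k x q = x (2 * k + 1 - q) by exact: (mirrorE cx).
(* One of t + p and t + (2k+1-p) is even, so [loop_see] pins down [p] for [x] or for its mirror. *)
have pos t p : 3 <= t <= 2 * k - 3 -> p <= 2 * k -> e z (u t) -> e z (x p) ->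
    0 < p /\ ((p = t \/ p = t + 2) \/ (2 * k + 1 - p = t \/ 2 * k + 1 - p = t + 2)).
  move=> tk pk zt zp; have tk' : 3 <= t < 2 * k - 2 by clear -tk k3; lia.
  have h := loop_see cx lu tk' pk zt zp.
  have p0 : 0 < p by move: h; rewrite lt0n; case: eqP => // ->; case: ifP; clear -tk; lia.
  have zt' : e z (u' t) by rewrite uuE //; clear -tk; lia.
  have pk' : 2 * k + 1 - p <= 2 * k by clear -p0; lia.
  have zp' : e z (mirror k x (2 * k + 1 - p)).
    rewrite mE; last by clear; lia.
    by have -> : 2 * k + 1 - (2 * k + 1 - p) = p by clear -pk; lia.
  have h' := loop_see cmx lu' tk' pk' zt' zp'.
  split=> //; move: h h'; case: ifP => o; case: ifP => o'; clear -o o' tk pk p0; lia.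
have kx t : 3 <= t <= 2 * k - 3 -> e z (u t) -> e z (x t) -> e z (x (t + 2)) -> False.
  by move=> tk; apply: (no_cycle_twin cx lu n23 tk).
have kxm t : 3 <= t <= 2 * k - 3 -> e z (u t) -> e z (x (2 * k + 1 - t)) -> e z (x (2 * k + 1 - (t + 2))) -> False.
  move=> tk zt z1 z2; apply: (no_cycle_twin cmx lu' n23m tk).
  - by rewrite uuE //; clear -tk; lia.
  - by rewrite mE //; clear -tk; lia.
  - by rewrite mE //; clear -tk; lia.
have [//|c5] := leqP (cx' + cu) 2.
have [x1 u1] : 0 < cx' /\ 0 < cu by clear -c5 cx2 cu2; lia.
have [cx2'|cu2'] : 1 < cx' \/ 1 < cu by clear -c5 cx2 cu2; lia.
- have [p [p' [pp pk zp zp']]] := count2 cx2'; have [i ik zi] := count1 u1.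
  have tk : 3 <= 3 + i <= 2 * k - 3 by clear -ik; lia.
  have pe := xx p p' pp pk zp zp'.
  have [p0 h] := pos (3 + i) p tk ltac:(clear -pp pk; lia) zi zp.
  have [_ h'] := pos (3 + i) p' tk ltac:(clear -pk; lia) zi zp'.
  have {pe h h'} [[e1 e2]|[e1 e2]] : p = 3 + i /\ p' = 3 + i + 2 \/ p' = 2 * k + 1 - (3 + i) /\ p = 2 * k + 1 - (3 + i + 2).
    by move: pe h h' => [pe|pe] [[h|h]|[h|h]] [[h'|h']|[h'|h']]; clear -pe h h' tk pp pk k4 p0; lia.
  + by move: zp zp' => /=; rewrite e2 e1 => zp zp'; case: (kx _ tk zi zp zp').
  + by move: zp zp' => /=; rewrite e2 e1 => zp zp'; case: (kxm _ tk zi zp' zp).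
- have [i [i' [ii ik zi zi']]] := count2 cu2'; have [p pk zp] := count1 x1.
  have tk : 3 <= 3 + i <= 2 * k - 3 by clear -ik ii; lia.
  have tk' : 3 <= 3 + i' <= 2 * k - 3 by clear -ik ii; lia.
  have ie := vv i i' ii ik zi zi'; have pk' : p <= 2 * k by clear -pk; lia.
  have [p0 h] := pos (3 + i) p tk pk' zi zp; have [_ h'] := pos (3 + i') p tk' pk' zi' zp.
  have ie' : 3 + i' = 3 + i + 2 by clear -ie; lia.
  have tk2 : 2 <= 3 + i <= 2 * k - 4 by clear -tk tk' ie; lia.
  have {h h'} [e1|e1] : p = 3 + i + 2 \/ p = 2 * k + 1 - (3 + i + 2).
    by clear -h h' ie tk tk' p0 pk'; lia.
  + by move: zp zi' => /=; rewrite e1 ie' => zp zi'; case: (no_loop_twin cx lu n23 tk2 zi zi' zp).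
  + case: (@no_loop_twin _ u' z _ cmx lu' n23m tk2).
    * by rewrite uuE //; clear -tk; lia.
    * by rewrite -ie' uuE //; clear -tk'; lia.
    * by rewrite mE; [rewrite -e1 | clear -tk tk' ie; lia].
Qed.

End Undominated.

Definition side (V : finType) (e : rel V) x v := exists z, [/\ e v z, e z (x 2) & e z (x 4)].

(** The booleans say which of nine chosen vertices a given vertex sees. For k = 3 seeing at most two
    of them contradicts the count, as 4 · 9 > 2 · 17. *)
Lemma far_triples (x0 x1 x3 x4 x5 v m1 m2 t : bool) :
  ~~ (x0 && x1) -> ~~ (x0 && x3) -> ~~ (x0 && x4) -> ~~ (x0 && m1) -> ~~ (x0 && m2) ->
  ~~ (x1 && x4) -> ~~ (x1 && x5) -> ~~ (x1 && v) -> ~~ (x1 && m1) -> ~~ (x3 && x4) -> ~~ (x3 && m2) ->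
  ~~ (x3 && t) -> ~~ (x4 && x5) -> ~~ (x4 && m1) -> ~~ (x5 && v) -> ~~ (x5 && m2) -> ~~ (x5 && t) ->
  ~~ (v && m1) -> ~~ (v && t) -> ~~ (m1 && m2) -> ~~ (m2 && t) ->
  ~~ [&& m1, x3 & x5] -> ~~ [&& v, m2 & x4] ->
  x0 + (x1 + (x3 + (x4 + (x5 + (v + (m1 + (m2 + (t + 0)))))))) <= 2.
Proof.
by case: x0; case: x1 => //=; case: x3 => //=; case: x4 => //=; case: x5 => //=; case: v => //=; case: m1 => //=; case: m2 => //=; case: t.
Qed.

Lemma near_triples (x0 x1 x2 x3 x4 x5 x6 v m1 : bool) :
  ~~ (x0 && x1) -> ~~ (x0 && x3) -> ~~ (x0 && x4) -> ~~ (x0 && x6) -> ~~ (x0 && m1) ->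
  ~~ (x1 && x2) -> ~~ (x1 && x4) -> ~~ (x1 && x5) -> ~~ (x1 && v) -> ~~ (x1 && m1) ->
  ~~ (x2 && x3) -> ~~ (x2 && x5) -> ~~ (x2 && x6) -> ~~ (x3 && x4) -> ~~ (x3 && x6) -> ~~ (x4 && x5) ->
  ~~ (x5 && x6) -> ~~ (x6 && v) -> ~~ (x6 && m1) -> ~~ (v && m1) ->
  ~~ [&& v, x2 & x4] -> ~~ [&& v, x5 & x3] -> ~~ [&& v, x0 & x2 || x5] -> ~~ [&& m1, x2 & x4] -> ~~ [&& m1, x3 & x5] ->
  x0 + (x1 + (x2 + (x3 + (x4 + (x5 + (x6 + (v + (m1 + 0)))))))) <= 2.
Proof.
by case: x0; case: x1 => //=; case: x2 => //=; case: x3 => //=; case: x4 => //=; case: x5 => //=; case: x6 => //=; case: v => //=; case: m1.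
Qed.

(** * Closed walks of length 7, the case k = 3 *)

Section Seven.
Variables (V : finType) (e : rel V).
Hypotheses (e_sym : symmetric e) (og : no_short_odd e 3) (dns : dense e 3) (sat : saturated e 3).
Implicit Types (x u : nat -> V).

Lemma no_odd1 z a b : e a b -> ~~ (e z a && e z b).
Proof.
move=> ab; apply/negP => /andP[za zb]; have w : wlk e 1 a b by rewrite wlk1.
by have := see e_sym og za zb w isT.
Qed.

Lemma no_odd3 z p q a b : e a p -> e p q -> e q b -> ~~ (e z a && e z b).
Proof.
move=> ap pq qb; apply/negP => /andP[za zb].
have w : wlk e 3 a b by apply: (wlkS ap); apply: (wlkS pq); rewrite wlk1.
by have := see e_sym og za zb w isT.
Qed.

Lemma loop7 x u : loop e 3 x u ->
  [/\ u 0 = x 0, e (u 0) (u 1) /\ e (u 1) (u 2), e (u 2) (u 3) /\ e (u 3) (u 4), e (u 4) (u 5) & e (u 5) (x 1)].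
Proof. by case=> h0 us h5; split=> //; [split|split|]; apply: us. Qed.

Lemma cyc7 x : cyc e 3 x -> [/\ e (x 0) (x 1) /\ e (x 1) (x 2), e (x 2) (x 3) /\ e (x 3) (x 4), e (x 4) (x 5), e (x 5) (x 6) & e (x 6) (x 0)].
Proof. by move=> cx; have st := proj2 cx; do !split; rewrite ?st // -(cyc_closed cx) st. Qed.

Lemma far_seven x u : cyc e 3 x -> loop e 3 x u -> (forall p, ~~ e (u 2) (x p)) -> ~~ e (u 4) (x 5).
Proof.
move=> cx lu und; apply/negP => m2x5.
have [x01 [x12 x23]] : e (x 0) (x 1) /\ e (x 1) (x 2) /\ e (x 2) (x 3) by case: (cyc7 cx) => -[? ?] [? ?].
have [[x34 x45] [x56 x60]] : (e (x 3) (x 4) /\ e (x 4) (x 5)) /\ e (x 5) (x 6) /\ e (x 6) (x 0) by case: (cyc7 cx) => -[? ?] [? ?].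
case: (loop7 lu) => u0 [x0y yv] [vm1 m12] m2h hx1; rewrite u0 in x0y.
have n34 : ~~ e (u 3) (x 4) by exact: (@loop_rung V e 3 isT e_sym og dns sat x u 3 cx lu (und 3) isT).
(* The missing rung at 3 yields a walk of length 4 by saturation; its midpoint is the ninth vertex
   of the list. *)
have [t [t0 t4 ts]] := wlk_funP (sat n34).
have t01 : e (u 3) (t 1) by rewrite -t0 ts.
have t12 : e (t 1) (t 2) by rewrite ts.
have t23 : e (t 2) (t 3) by rewrite ts.
have t34 : e (t 3) (x 4) by rewrite -[x 4]t4 ts.
have S a b : e a b -> e b a by rewrite e_sym.
pose L := [:: x 0; x 1; x 3; x 4; x 5; u 2; u 3; u 4; t 2].
suff cL z : count (e z) L <= 2 by have := dense_count e_sym dns (_ : L != [::]) cL => /(_ isT).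
have k1 : ~~ [&& e z (u 3), e z (x 3) & e z (x 5)].
  by apply/and3P => -[z1 z2 z3]; apply: (@no_cycle_twin V e 3 isT e_sym og dns sat x u z 3 cx lu (und 3) isT z1 z2 z3).
have k2 : ~~ [&& e z (u 2), e z (u 4) & e z (x 4)].
  by apply/and3P => -[z1 z2 z3]; apply: (@no_loop_twin V e 3 isT e_sym og dns sat x u z 2 cx lu (und 3) isT z1 z2 z3).
apply: far_triples k1 k2; try (exact: no_odd1); try (apply: no_odd1; exact: S).
- exact: (no_odd3 _ x01 x12 x23).
- exact: (no_odd3 _ (S _ _ x60) (S _ _ x56) (S _ _ x45)).
- exact: (no_odd3 _ x0y yv vm1).
- exact: (no_odd3 _ (S _ _ x60) (S _ _ x56) (S _ _ m2x5)).
- exact: (no_odd3 _ x12 x23 x34).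
- exact: (no_odd3 _ (S _ _ x01) (S _ _ x60) (S _ _ x56)).
- exact: (no_odd3 _ (S _ _ x01) x0y yv).
- exact: (no_odd3 _ (S _ _ hx1) (S _ _ m2h) (S _ _ m12)).
- exact: (no_odd3 _ x34 x45 (S _ _ m2x5)).
- exact: (no_odd3 _ x34 (S _ _ t34) (S _ _ t23)).
- exact: (no_odd3 _ x45 (S _ _ m2x5) (S _ _ m12)).
- exact: (no_odd3 _ (S _ _ m2x5) (S _ _ m12) (S _ _ vm1)).
- exact: (no_odd3 _ (S _ _ x45) (S _ _ t34) (S _ _ t23)).
- exact: (no_odd3 _ vm1 t01 t12).
- exact: (no_odd3 _ (S _ _ m12) t01 t12).
Qed.

(** As u 5 is adjacent to both x 1 and x 6, [u] is a loop for [x] and for its mirror. If all three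
    outcomes fail, nine vertices are seen at most twice each. *)
Lemma near_step x u : cyc e 3 x -> loop e 3 x u -> (forall p, ~~ e (u 2) (x p)) -> e (u 5) (x 6) ->
  [\/ side e x (u 2), side e (mirror 3 x) (u 2) | exists z, [/\ e (u 2) z, e z (x 0) & e z (x 2) || e z (x 5)]].
Proof.
move=> cx lu und hx6; have cmx := mirror_cyc e_sym cx.
have [x01 [x12 x23]] : e (x 0) (x 1) /\ e (x 1) (x 2) /\ e (x 2) (x 3) by case: (cyc7 cx) => -[? ?] [? ?].
have [[x34 x45] [x56 x60]] : (e (x 3) (x 4) /\ e (x 4) (x 5)) /\ e (x 5) (x 6) /\ e (x 6) (x 0) by case: (cyc7 cx) => -[? ?] [? ?].
case: (loop7 lu) => u0 [x0y yv] [vm1 m12] m2h hx1; rewrite u0 in x0y.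
have S a b : e a b -> e b a by rewrite e_sym.
have mE p : p <= 7 -> mirror 3 x p = x (7 - p) by exact: (mirrorE cx).
have lum : loop e 3 (mirror 3 x) u.
  by case: lu => h1 h2 _; split=> //; rewrite mE.
have n23m : ~~ e (u 2) (mirror 3 x 3) by rewrite mE.
pose L := [:: x 0; x 1; x 2; x 3; x 4; x 5; x 6; u 2; u 3].
have [/existsP[z]|no] := boolP [exists z, [|| [&& e (u 2) z, e z (x 2) & e z (x 4)], [&& e (u 2) z, e z (x 5) & e z (x 3)] |
   [&& e (u 2) z, e z (x 0) & e z (x 2) || e z (x 5)]]].
  case/or3P=> /and3P[h1 h2 h3]; [apply: Or31|apply: Or32|apply: Or33]; exists z => //.
  by rewrite !mE.
suff cL z : count (e z) L <= 2 by have := dense_count e_sym dns (_ : L != [::]) cL => /(_ isT).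
move: no; rewrite negb_exists => /forallP/(_ z); rewrite !negb_or e_sym => /and3P[b1 b2 b3].
have k1 : ~~ [&& e z (u 3), e z (x 3) & e z (x 5)].
  by apply/and3P => -[z1 z2 z3]; apply: (@no_cycle_twin V e 3 isT e_sym og dns sat x u z 3 cx lu (und 3) isT z1 z2 z3).
have k2 : ~~ [&& e z (u 3), e z (x 2) & e z (x 4)].
  apply/and3P => -[z1 z2 z3]; apply: (@no_cycle_twin V e 3 isT e_sym og dns sat (mirror 3 x) u z 3 cmx lum n23m isT z1); by rewrite mE.
apply: near_triples b1 b2 b3 k2 k1; try (exact: no_odd1); try (apply: no_odd1; exact: S).
- exact: (no_odd3 _ x01 x12 x23).
- exact: (no_odd3 _ (S _ _ x60) (S _ _ x56) (S _ _ x45)).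
- exact: (no_odd3 _ x0y yv vm1).
- exact: (no_odd3 _ x12 x23 x34).
- exact: (no_odd3 _ (S _ _ x01) (S _ _ x60) (S _ _ x56)).
- exact: (no_odd3 _ (S _ _ x01) x0y yv).
- exact: (no_odd3 _ (S _ _ hx1) (S _ _ m2h) (S _ _ m12)).
- exact: (no_odd3 _ x23 x34 x45).
- exact: (no_odd3 _ (S _ _ x12) (S _ _ x01) (S _ _ x60)).
- exact: (no_odd3 _ x34 x45 x56).
- exact: (no_odd3 _ x60 x0y yv).
- exact: (no_odd3 _ (S _ _ hx6) (S _ _ m2h) (S _ _ m12)).
Qed.

Lemma no_pentagon a b c d f : e a b -> e b c -> e c d -> e d f -> ~~ e f a.
Proof.
move=> ab bc cd df; apply/negP => fa.
have w : wlk e 5 a a by apply: (wlkS ab); apply: (wlkS bc); apply: (wlkS cd); apply: (wlkS df); rewrite wlk1.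
by have := @og 5 a isT w.
Qed.

(** Exchange the roles of x 0 and u 5: put u 5 on the cycle and run the loop backwards, so that u 3
    plays the part of u 2. Each outcome of [near_step] there is a twin, a pentagon using the edge
    from u 1 to x 2, or a loop forbidden by [far_seven]. *)
Lemma near_far x u : cyc e 3 x -> loop e 3 x u -> (forall p, ~~ e (u 2) (x p)) -> e (u 5) (x 6) -> ~~ e (u 1) (x 2).
Proof.
move=> cx lu und hx6; apply/negP => yx2; have cmx := mirror_cyc e_sym cx.
have [x01 [x12 x23]] : e (x 0) (x 1) /\ e (x 1) (x 2) /\ e (x 2) (x 3) by case: (cyc7 cx) => -[? ?] [? ?].
have [[x34 x45] [x56 x60]] : (e (x 3) (x 4) /\ e (x 4) (x 5)) /\ e (x 5) (x 6) /\ e (x 6) (x 0) by case: (cyc7 cx) => -[? ?] [? ?].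
case: (loop7 lu) => u0 [x0y yv] [vm1 m12] m2h hx1; rewrite u0 in x0y.
have S a b : e a b -> e b a by rewrite e_sym.
have mE p : p <= 7 -> mirror 3 x p = x (7 - p) by exact: (mirrorE cx).
have lum : loop e 3 (mirror 3 x) u by case: lu => h1 h2 _; split=> //; rewrite mE.
have n23m : ~~ e (u 2) (mirror 3 x 3) by rewrite mE.
have cs : cyc e 3 (swap 3 x 0 (u 5)) by apply: swap_cyc.
have sE p : p <= 6 -> swap 3 x 0 (u 5) p = if p == 0 then u 5 else x p by exact: (@swapE V 3 x 0 (u 5) p).
have xmod p : x p = x (p %% 7) by rewrite {1}(divn_eq p 7) addnC (periodic_mul _ _ (proj1 cx)).
have n31 : ~~ e (u 3) (x 1) by rewrite e_sym; apply: (no_pentagon (S _ _ vm1) (S _ _ yv) (S _ _ x0y) x01).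
have n36 : ~~ e (u 3) (x 6) by rewrite e_sym; apply: (no_pentagon (S _ _ vm1) (S _ _ yv) (S _ _ x0y) (S _ _ x60)).
have n32 : ~~ e (u 3) (x 2) by rewrite e_sym; apply: (no_pentagon m12 m2h hx1 x12).
have n35 : ~~ e (u 3) (x 5) by rewrite e_sym; apply: (no_pentagon m12 m2h hx6 (S _ _ x56)).
have n34 : ~~ e (u 3) (x 4) := @loop_rung V e 3 isT e_sym og dns sat x u 3 cx lu (und 3) isT.
have n33 : ~~ e (u 3) (x 3).
  by have := @loop_rung V e 3 isT e_sym og dns sat (mirror 3 x) u 3 cmx lum n23m isT; rewrite mE.
have n3h : ~~ e (u 3) (u 5).
  by apply/negP => m1h; apply: (no_triangle (_ : 1 < 3) e_sym og m12 m2h m1h).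
pose s i := u (5 - i).
have ls : loop e 3 (swap 3 x 0 (u 5)) s.
  split; first by rewrite /s sE.
    move=> i i5; rewrite /s e_sym; case: lu => _ us _.
    by have := us (5 - i.+1); rewrite -subSn ?subSS //; apply; clear; lia.
  by rewrite /s subnn u0 sE.
have unds p : ~~ e (s 2) (swap 3 x 0 (u 5) p).
  rewrite /s /swap -[_ - _]/3 -[2 * 3 + 1]/7; case: eqP => // p0.
  rewrite xmod; have := ltn_pmod p (isT : 0 < 7); move: p0; move: (p %% 7).
  by case=> [|[|[|[|[|[|[|r]]]]]]].
have hs : e (s 5) (swap 3 x 0 (u 5) 6) by rewrite /s subnn u0 sE // e_sym.
have und2 : ~~ e (s 2) (swap 3 x 0 (u 5) 3) by exact: unds.
have [[z [h1 h2 h3]]|[z [h1 h2 h3]]|[z [h1 h2 h3]]] := near_step cs ls unds hs.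
- have z3 : e z (u 3) by apply: S.
  rewrite !sE // in h2 h3; apply: (@no_cycle_twin V e 3 isT e_sym og dns sat (mirror 3 x) u z 3 cmx lum n23m isT z3); by rewrite mE.
- have z3 : e z (u 3) by apply: S.
  rewrite !(mirrorE cs) // !sE // in h2 h3.
  by apply: (@no_cycle_twin V e 3 isT e_sym og dns sat x u z 3 cx lu (und 3) isT z3).
rewrite !sE // in h2 h3; case/orP: h3 => zx.
  by have /negP[] := no_pentagon (S _ _ zx) (S _ _ h1) (S _ _ vm1) (S _ _ yv).
pose u' i := if i == 4 then z else u i.
have lu' : loop e 3 x u'.
  case: lu => l0 l1 l5; split=> // i i5; rewrite /u'.
  case: eqP => [->|n4] //=; case: eqP => [[->]|n5] //=; exact: l1.
by have /negP[] := far_seven cx lu' und.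
Qed.

(** In the third outcome of [near_step], replacing u 1 by [z] produces the edge that [near_far]
    forbids, on [x] or on its mirror. *)
Lemma near_seven x u : cyc e 3 x -> loop e 3 x u -> (forall p, ~~ e (u 2) (x p)) -> e (u 5) (x 6) ->
  side e x (u 2) \/ side e (mirror 3 x) (u 2).
Proof.
move=> cx lu und hx6; case: (near_step cx lu und hx6) => [h|h|[z [h1 h2 h3]]]; [by left|by right|].
have cmx := mirror_cyc e_sym cx.
have mE p : p <= 7 -> mirror 3 x p = x (7 - p) by exact: (mirrorE cx).
pose u' i := if i == 1 then z else u i.
have st i : i < 5 -> e (u' i) (u' i.+1).
  case: lu => l0 l1 _; rewrite /u'; case: i => [|[|i]] //= i5; last exact: l1.
    by rewrite l0 e_sym.
  by rewrite e_sym.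
case/orP: h3 => zx.
- have lu' : loop e 3 x u' by case: lu => l0 l1 l5; split.
  by have /negP[] := near_far cx lu' und hx6.
- have lu' : loop e 3 (mirror 3 x) u' by case: lu => l0 l1 l5; split=> //; rewrite mE.
  have undm p : ~~ e (u' 2) (mirror 3 x p) by exact: und.
  have hm : e (u' 5) (mirror 3 x 6) by rewrite mE //; case: lu.
  by have /negP[] := near_far cmx lu' undm hm; rewrite mE.
Qed.

End Seven.

(** The rung at 2k-2 lies beyond the range of [loop_rung]. For k >= 4 it would let the loop end at x
    (2k-1) instead, making it a loop for the mirror as well. *)
Lemma far_loop (V : finType) (e : rel V) k x u : 2 < k -> symmetric e -> no_short_odd e k -> dense e k -> saturated e k ->
  cyc e k x -> loop e k x u -> (forall p, ~~ e (u 2) (x p)) -> ~~ e (u (2 * k - 2)) (x (2 * k - 1)).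
Proof.
move=> k3 es og dns sat cx lu und; have [k4|ke] : 3 < k \/ k = 3 by clear -k3; lia.
  apply/negP => h; pose u' i := if i == 2 * k - 1 then x (2 * k - 1) else u i.
  have mE p : p <= 2 * k + 1 -> mirror k x p = x (2 * k + 1 - p) by exact: (mirrorE cx).
  have lu' : loop e k (mirror k x) u'.
    case: lu => l0 l1 l2; rewrite /u'; split.
    - have -> : (0 == 2 * k - 1) = false by clear -k3; lia.
      by rewrite l0 /mirror muln0.
    - move=> i ik; have -> : (i == 2 * k - 1) = false by clear -ik; lia.
      case: eqP => [ie|_]; last exact: l1.
      by have -> : i = 2 * k - 2 by clear -ie; lia.
    - rewrite eqxx mE; last by clear; lia.
      have -> : 2 * k + 1 - 1 = (2 * k - 1).+1 by clear -k3; lia.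
      exact: (proj2 cx).
  apply: (two_loops k3 es og dns sat k4 cx lu lu' _ (und 3)) => [i ik|]; last exact: und.
  by rewrite /u'; have -> : (i == 2 * k - 1) = false by clear -ik k3; lia.
subst k; exact: (far_seven es og dns sat cx lu und).
Qed.

(** The rung at 2k-1 makes [u] a loop for both [x] and its mirror. For k >= 4 this is contradictory
    by [two_loops], so the conclusion carries content only for k = 3. *)
Lemma near_loop (V : finType) (e : rel V) k x u : 2 < k -> symmetric e -> no_short_odd e k -> dense e k -> saturated e k ->
  cyc e k x -> loop e k x u -> (forall p, ~~ e (u 2) (x p)) -> e (u (2 * k - 1)) (x (2 * k)) ->
  side e x (u 2) \/ side e (mirror k x) (u 2).
Proof.
move=> k3 es og dns sat cx lu und h; have [k4|ke] : 3 < k \/ k = 3 by clear -k3; lia.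
  have mE p : p <= 2 * k + 1 -> mirror k x p = x (2 * k + 1 - p) by exact: (mirrorE cx).
  have lu' : loop e k (mirror k x) u.
    case: lu => l0 l1 l2; split=> //; first by rewrite l0 /mirror muln0.
    rewrite mE; last by clear; lia.
    by have -> : 2 * k + 1 - 1 = 2 * k by clear; lia.
  by case: (two_loops k3 es og dns sat k4 cx lu lu' _ (und 3)) => [i ik|]; [ | exact: und].
subst k; exact: (near_seven es og dns sat cx lu und).
Qed.

(** * Every closed walk of length 2k+1 is dominating *)

Section Dominating.
Variables (V : finType) (e : rel V) (k : nat).
Hypotheses (k3 : 2 < k) (e_sym : symmetric e) (og : no_short_odd e k).
Hypotheses (dns : dense e k) (sat : saturated e k).
Implicit Types (x u w : nat -> V).

Definition undominated x v y := [/\ cyc e k x, forall p, ~~ e v (x p), e v y & e y (x 0)].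

Lemma undominated_mirror x v y : undominated x v y -> undominated (mirror k x) v y.
Proof. by case=> cx und vy yx; split=> //; [apply: (mirror_cyc e_sym cx) | move=> p; apply: und | rewrite /mirror muln0]. Qed.

Definition via (a y : V) w i := if i is j.+2 then w j else if i is 1 then y else a.

Lemma via_loop x v y w' : undominated x v y -> escape e k (mirror k x) v w' ->
  loop e k x (via (x 0) y w') /\ via (x 0) y w' 2 = v.
Proof.
case=> cx und vy yx [w0 wl ws]; split; last by rewrite /= w0.
split=> //.
- case=> [|[|i]] ik /=; rewrite ?w0 1?e_sym //; rewrite e_sym; apply: ws; clear -ik; lia.
- have -> : 2 * k - 1 = (2 * k - 3).+2 by clear -k3; lia.
  have -> : x 1 = mirror k x (2 * k).
    rewrite (mirrorE cx); last by clear; lia.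
    by have -> : 2 * k + 1 - 2 * k = 1 by clear; lia.
  rewrite /= -wl; have := ws (2 * k - 3) ltac:(clear -k3; lia).
  by have -> : (2 * k - 3).+1 = 2 * k - 2 by clear -k3; lia.
Qed.

(** Rerouting through [z] gives a loop with a rung. A rung up to 2k-3 is excluded by [loop_rung],
    one at 2k-2 by [far_loop], and one at 2k-1 leads to [side] by [near_loop]. *)
Lemma shortcut_side x v y w w' z : undominated x v y -> escape e k x v w -> escape e k (mirror k x) v w' -> shortcut e k x w w' z ->
  side e x v \/ side e (mirror k x) v.
Proof.
move=> cf ew ew'; have [cx und vy yx] := cf; have [lu u2] := via_loop cf ew'.
have undu p : ~~ e (via (x 0) y w' 2) (x p) by rewrite u2.
have uE i : via (x 0) y w' i.+2 = w' i by [].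
have k2 : 2 * k - 2 = (2 * k - 4).+2 by clear -k3; lia.
have S a b : e a b -> e b a by rewrite e_sym.
case=> [[i [ik zi zx /orP[zi2|zx2]]]|[z1 z2 zw]].
- pose u i' := if i' == i + 3 then z else via (x 0) y w' i'.
  have lu' : loop e k x u.
    case: lu => l0 l1 l2; rewrite /u; split.
    - by have -> : (0 == i + 3) = false by clear; lia.
    - move=> j jk; case: eqP => [je|_]; case: eqP => [je'|_]; last exact: l1.
      + by clear -je je'; lia.
      + have -> : j.+1 = (i + 2).+2 by clear -je; lia.
        by rewrite uE.
      + have -> : j = i.+2 by clear -je'; lia.
        by rewrite uE e_sym.
    - case: eqP => [ie|_] //; have := ew' => -[_ wl _].
      have i2 : i + 2 = 2 * k - 2 by clear -ie; lia.
      rewrite i2 wl (mirrorE cx) in zi2; last by clear; lia.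
      have e1 : 2 * k + 1 - 2 * k = 1 by clear; lia.
      by rewrite e1 in zi2.
  have u2' : u 2 = v by rewrite /u; have -> : (2 == i + 3) = false by clear; lia.
  have undu' p : ~~ e (u 2) (x p) by rewrite u2'.
  have ui : u (i + 3) = z by rewrite /u eqxx.
  have zx' : e (u (i + 3)) (x (i + 3).+1) by rewrite ui -addnS.
  have [g|[g|g]] : i + 3 <= 2 * k - 3 \/ i + 3 = 2 * k - 2 \/ i + 3 = 2 * k - 1 by clear -ik k3; lia.
  + have gk : 3 <= i + 3 <= 2 * k - 3 by rewrite g leq_addl.
    by have /negP[] := loop_rung k3 e_sym og dns sat cx lu' (undu' 3) gk.
  + have /negP[] := far_loop k3 e_sym og dns sat cx lu' undu'.
    by move: zx'; rewrite g; have -> : (2 * k - 2).+1 = 2 * k - 1 by clear -k3; lia.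
  + rewrite -u2'; apply: (near_loop k3 e_sym og dns sat cx lu' undu').
    by move: zx'; rewrite g; have -> : (2 * k - 1).+1 = 2 * k by clear -k3; lia.
- have [i0|ipos] := posnP i.
    left; exists z; rewrite i0 in zi zx zx2; split=> //.
    by rewrite e_sym; case: ew' => <-.
  have sE p : p <= 2 * k -> swap k x (i + 3) z p = if p == i + 3 then z else x p by exact: swapE.
  have cs : cyc e k (swap k x (i + 3) z).
    apply: (swap_cyc k3 e_sym cx); first by clear -ik k3; lia.
      have -> : i + 3 + 2 * k = i + 2 + (2 * k + 1) by clear; lia.
      by rewrite (proj1 cx).
    by have -> : i + 3 + 1 = i + 4 by clear; lia.
  have ls : loop e k (swap k x (i + 3) z) (via (x 0) y w').
    case: lu => l0 l1 l2; split=> //; rewrite sE; try by clear -k3; lia.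
    + by have -> : (0 == i + 3) = false by clear; lia.
    + by have -> : (1 == i + 3) = false by clear; lia.
  have n23 : ~~ e (via (x 0) y w' 2) (swap k x (i + 3) z 3).
    rewrite sE; last by clear -k3; lia.
    by have -> : (3 == i + 3) = false by clear -ipos; lia.
  have rg : e (via (x 0) y w' (i + 2)) (swap k x (i + 3) z (i + 2).+1).
    rewrite sE; last by clear -ik k3; lia.
    have -> : (i + 2).+1 = i + 3 by clear; lia.
    by rewrite eqxx addn2 uE e_sym.
  have [g|g] : i + 2 <= 2 * k - 3 \/ i + 2 = 2 * k - 2 by clear -ik k3; lia.
    have gk : 3 <= i + 2 <= 2 * k - 3 by rewrite g addn2 !ltnS ipos.
    by have /negP[] := loop_rung k3 e_sym og dns sat cs ls n23 gk.
  (* Putting [z] on the cycle must leave [v] undominated: here i + 4 = 2k, so an edge from [v] to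
     [z] would close a walk of length 5 through x (2k), x 0 and y. *)
  have vz : ~~ e v z.
    apply/negP => vz; have zk : e z (x (2 * k)) by move: zx; have -> : i + 4 = 2 * k by clear -g k3; lia.
    have xk : e (x (2 * k)) (x 0) by rewrite -(cyc_closed cx) addn1; apply: (proj2 cx).
    have w5 : wlk e 5 v v.
      by apply: (wlkS vz); apply: (wlkS zk); apply: (wlkS xk); apply: (wlkS (S _ _ yx)); rewrite wlk1 e_sym.
    by have := @og 5 v isT w5; clear -k3; lia.
  have unds p : ~~ e (via (x 0) y w' 2) (swap k x (i + 3) z p) by rewrite u2 /swap; case: ifP.
  have /negP[] := far_loop k3 e_sym og dns sat cs ls unds.
  by move: rg; rewrite g; have -> : (2 * k - 2).+1 = 2 * k - 1 by clear -k3; lia.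
- pose u i := if i == 2 * k - 1 then z else via (x 0) y w i.
  have [w0 wl ws] := ew.
  have lu' : loop e k x u.
    rewrite /u; split.
    - by have -> : (0 == 2 * k - 1) = false by clear -k3; lia.
    - move=> j jk; have -> : (j == 2 * k - 1) = false by clear -jk; lia.
      case: eqP => [je|jn].
        have -> : j = (2 * k - 4).+2 by clear -je k3; lia.
        by rewrite e_sym.
      case: j jk jn => [|[|j]] jk jn /=; rewrite ?w0 1?e_sym //; rewrite e_sym; apply: ws; clear -jk; lia.
    - by rewrite eqxx.
  have u2' : u 2 = v by rewrite /u; have -> : (2 == 2 * k - 1) = false by clear -k3; lia.
  have undu' p : ~~ e (u 2) (x p) by rewrite u2'.
  rewrite -u2'; apply: (near_loop k3 e_sym og dns sat cx lu' undu').
  by rewrite /u eqxx.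
Qed.

Lemma undominated_escape x v y : undominated x v y -> exists w, escape e k x v w.
Proof. by case=> cx und _ _; have [w [w0 wl ws]] := wlk_funP (sat (und (2 * k))); exists w. Qed.

Lemma undominated_side x v y : undominated x v y -> side e x v \/ side e (mirror k x) v.
Proof.
move=> cf; have cfm := undominated_mirror cf; have [cx _ vy yx] := cf.
have [w ew] := undominated_escape cf; have [w' ew'] := undominated_escape cfm.
have [z [gz|gz]] := escape_shortcut k3 e_sym og dns cx vy yx ew ew'; first exact: shortcut_side cf ew ew' gz.
have ewK : escape e k (mirror k (mirror k x)) v w by case: ew => h1 h2 h3; split=> //; rewrite (mirrorK k3 _ cx).
have [h|[z' [h1 h2 h3]]] := shortcut_side cfm ew' ewK gz; first by right.
by left; exists z'; rewrite !(mirrorK k3 _ cx) in h2 h3.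
Qed.

Lemma no_short_arc x v z z' a b : cyc e k x -> e v z -> e v z' -> e z (x a) -> e z' (x b) ->
  a <= b -> odd (b - a) -> b - a <= 2 * k - 5 -> False.
Proof.
move=> cx vz vz' za zb ab od le.
have w1 : wlk e 1 (x b) z' by rewrite wlk1 e_sym.
have w2 : wlk e 1 z' v by rewrite wlk1 e_sym.
have w := wlk_cat (wlk_cat (wlkS vz (wlkS za (cyc_seg cx ab))) w1) w2.
have := og _ w; clear -od le k3; lia.
Qed.

(* The vertices of [side] may serve as new hooks [y], moving the base point along [x]
   until two of them span an odd closed walk of length [2 * k - 1]. *)
Lemma no_undominated x v y : ~ undominated x v y.
Proof.
suff main x' y' : undominated x' v y' -> side e x' v -> False.
  move=> cf; case: (undominated_side cf) => h; [exact: main cf h | exact: main (undominated_mirror cf) h].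
move=> [cx und _ _] [z3 [vz3 z32 z34]].
have cf4 : undominated (fun i => x' (4 + i)) v z3 by split=> //; apply: cyc_shift.
have cf2 : undominated (fun i => x' (2 + i)) v z3 by split=> //; apply: cyc_shift.
have per i : x' (i + (2 * k + 1)) = x' i by case: cx.
have m4 p : p <= 2 * k + 1 -> mirror k (fun i => x' (4 + i)) p = x' (4 + (2 * k + 1 - p)).
  by move=> pk; case: cf4 => c4 _ _ _; rewrite (mirrorE c4).
have m2 p : p <= 2 * k + 1 -> mirror k (fun i => x' (2 + i)) p = x' (2 + (2 * k + 1 - p)).
  by move=> pk; case: cf2 => c2 _ _ _; rewrite (mirrorE c2).
(* The index of each hook names the vertex of the walk between its two neighbours there. Every arc
   used below has length 2k-5, hence closes through two hooks and [v] to length 2k-1. *)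
have [[z7 [vz7 z76 z78]]|[z1 [vz1 z12 z10]]] := undominated_side cf4.
  rewrite -(per 2) in z32.
  by apply: (no_short_arc cx vz7 vz3 z78 z32); clear -k3; lia.
have {}z10 : e z1 (x' (0 + (2 * k + 1))).
  by move: z10; rewrite m4; [congr (e z1 (x' _)) | ]; clear -k3; lia.
have [[z5 [vz5 z54 z56]]|[z [vz _ zm]]] := undominated_side cf2.
  by apply: (no_short_arc cx vz5 vz1 z56 z10); clear -k3; lia.
have {}zm : e z (x' (2 * k - 1)).
  by move: zm; rewrite m2; [congr (e z (x' _)) | ]; clear -k3; lia.
by apply: (no_short_arc cx vz3 vz z34 zm); clear -k3; lia.
Qed.

(** On a walk from an undominated vertex to x 0, the vertex before the first dominated one would
    satisfy [undominated] after a shift of [x]. *)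
Lemma cyc_dominating x v : cyc e k x -> exists2 p, p <= 2 * k & e v (x p).
Proof.
move=> cx; pose dom a := [exists p : 'I_(2 * k).+1, e a (x p)].
have domP a : dom a -> exists2 p, p <= 2 * k & e a (x p).
  by case/existsP=> p ap; exists p => //; rewrite -ltnS.
have undom a : ~~ dom a -> forall p, ~~ e a (x p).
  rewrite negb_exists => /forallP na p; apply/negP => ap.
  have pm : p %% (2 * k + 1) < (2 * k).+1 by rewrite -[(2 * k).+1]addn1 ltn_pmod // addn1.
  have /negP[] := na (Ordinal pm); move: ap.
  by rewrite {1}(divn_eq p (2 * k + 1)) addnC (periodic_mul _ _ (proj1 cx)).
have [/domP //|nv] := boolP (dom v).
have [f [f0 fl fs]] := wlk_funP (sat (undom _ nv 0)).
have ex : exists i, (i <= 2 * k - 2) && dom (f i).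
  exists (2 * k - 2); rewrite leqnn fl; apply/existsP.
  have k1 : 1 < (2 * k).+1 by clear -k3; lia.
  by exists (Ordinal k1); apply: (proj2 cx).
case: (ex_minnP ex) => [[|i]]; first by rewrite f0 (negPf nv) andbF.
case/andP=> ik /domP[p pk fp] imin.
have ni : ~~ dom (f i).
  by apply/negP => di; have := imin i; rewrite di andbT => /(_ (ltnW ik)); rewrite ltnn.
case: (@no_undominated (fun j => x (p + j)) (f i) (f i.+1)); split.
- exact: cyc_shift.
- by move=> j; apply: undom.
- exact: fs.
- by rewrite addn0.
Qed.

End Dominating.

(** * Bipartiteness off a neighbourhood, k >= 3 *)

Section Coloring.
Variables (V : finType) (e : rel V) (k : nat).
Hypotheses (k3 : 2 < k) (e_sym : symmetric e) (og : no_short_odd e k).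
Hypotheses (dns : dense e k) (sat : saturated e k).

Lemma cyc_of f : (forall i, i < 2 * k + 1 -> e (f i) (f i.+1)) -> f (2 * k + 1) = f 0 ->
  cyc e k (fun i => f (i %% (2 * k + 1))).
Proof.
move=> st cl; split=> i; first by rewrite modnDr.
have k0 : 0 < 2 * k + 1 by rewrite addn1.
have sm : i.+1 %% (2 * k + 1) = (i %% (2 * k + 1)).+1 %% (2 * k + 1).
  by rewrite -[(i %% _).+1]addn1 modnDml [i + 1]addn1.
rewrite sm; move: (ltn_pmod i k0); move: (i %% _) => r rk.
have [lt|re] : r.+1 < 2 * k + 1 \/ r.+1 = 2 * k + 1 by clear -rk; lia.
  by rewrite (modn_small lt) st.
by rewrite re modnn -cl -re st.
Qed.

(** If a shortest odd closed walk is longer than 2k+1, then F 0 and F 3 are nonadjacent, and the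
    walk of length 2k-2 between them closes with the arc of length 3. *)
Lemma cyc_exists : (exists d x, odd d && wlk e d x x) -> exists x, cyc e k x.
Proof.
move=> ex; have [l [F [Fper FP Fmin]]] := shortest_odd ex.
have Fc : F l.*2.+1 = F 0 by rewrite -[l.*2.+1]add0n Fper.
have lk : 2 * k < l.*2.+1.
  apply: (@og _ (F 0)); first by rewrite /= odd_double.
  by have := wlk_periodic FP (leq0n l.*2.+1); rewrite Fc subn0.
have [le|lt] : l.*2.+1 = 2 * k + 1 \/ 2 * k + 1 < l.*2.+1 by clear -lk; lia.
  by exists F; split=> // i; rewrite -le Fper.
have n03 : ~~ e (F 0) (F 3).
  apply/negP => e03; have l3 : 3 <= l.*2.+1 by clear -lk k3; lia.
  have w := wlkS e03 (wlk_periodic FP l3); rewrite Fc in w.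
  by have := Fmin _ _ _ w => /(_ ltac:(clear -l3; lia)); clear -l3; lia.
have w3 := wlk_sym e_sym (wlk_periodic FP (leq0n 3)).
have w := wlk_cat (sat n03) w3.
have [f [f0 fl fs]] := wlk_funP w.
have ke : 2 * k - 2 + (3 - 0) = 2 * k + 1 by clear -k3; lia.
rewrite ke in fl fs; exists (fun i => f (i %% (2 * k + 1))).
by apply: cyc_of => //; rewrite fl f0.
Qed.

Variable x : nat -> V.
Hypothesis cx : cyc e k x.

(** Positions 0, 1 and 2k are left out so that two positions of equal parity are at most 2k-4
    apart. *)
Definition sees b z := [exists q : 'I_(2 * k), [&& 2 <= q, odd q == b & e z (x q)]].

Lemma seesP b z : reflect (exists q, [/\ 2 <= q, q < 2 * k, odd q = b & e z (x q)]) (sees b z).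
Proof.
apply: (iffP existsP) => [[q /and3P[q2 /eqP oq zq]]|[q [q2 qk oq zq]]].
  by exists q; split.
by exists (Ordinal qk); rewrite /= q2 oq zq eqxx.
Qed.

Lemma seg_sym i j : exists2 d, wlk e d (x i) (x j) & d = (i - j) + (j - i).
Proof.
have [ij|/ltnW ji] := leqP i j.
  by exists (j - i); [apply: cyc_seg cx _ | clear -ij; lia].
by exists (i - j); [apply: (wlk_sym e_sym); apply: cyc_seg cx _ | clear -ji; lia].
Qed.

Lemma sees_edge b z w : e z w -> sees b z -> ~~ sees b w.
Proof.
move=> zw /seesP[q [q2 qk oq zq]]; apply/negP => /seesP[q' [q2' qk' oq' zq']].
have wz : wlk e 1 (x q') w by rewrite wlk1 e_sym.
have [d wd de] := seg_sym q q'; have := see e_sym og zq zw (wlk_cat wd wz).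
clear -de q2 qk oq q2' qk' oq' k3; lia.
Qed.

(** The parity rule forces the extreme positions 2 and 2k-1. Then z, w, x 2, ..., x (2k-1), w' is a
    closed walk of length 2k+1, so it dominates x 0, which none of its vertices allows. *)
Lemma sees_far z w w' : ~~ e (x 0) z -> ~~ e (x 0) w -> ~~ e (x 0) w' -> e z w -> e z w' ->
  sees false w -> ~~ sees true w'.
Proof.
move=> nz nw nw' zw zw' /seesP[q [q2 qk oq wq]]; apply/negP => /seesP[q' [q2' qk' oq' wq']].
have w1 : wlk e 1 w (x q) by rewrite wlk1.
have w2 : wlk e 1 (x q') w' by rewrite wlk1 e_sym.
have [d wd de] := seg_sym q q'; have h := see e_sym og zw zw' (wlk_cat (wlk_cat w1 wd) w2).
have [qe qe'] : q = 2 /\ q' = 2 * k - 1 by clear -h de q2 qk oq q2' qk' oq' k3; lia.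
subst q q'; pose f i := match i with 0 => z | 1 => w | _ => if i < 2 * k then x i else if i == 2 * k then w' else z end.
have cf : cyc e k (fun i => f (i %% (2 * k + 1))).
  apply: cyc_of => [i ik|]; last first.
    rewrite /f; have -> : 2 * k + 1 = (2 * k - 1).+2 by clear -k3; lia.
    have -> : (2 * k - 1).+2 < 2 * k = false by clear -k3; lia.
    by have -> : ((2 * k - 1).+2 == 2 * k) = false by clear -k3; lia.
  case: i ik => [|[|i]] ik //=.
    by have -> : 2 < 2 * k by clear -k3; lia.
  have [h1|[h1|h1]] : i.+3 < 2 * k \/ i.+3 = 2 * k \/ i.+2 = 2 * k by clear -ik; lia.
  - by rewrite h1 (ltn_trans (ltnSn _) h1); apply: (proj2 cx).
  - rewrite h1 ltnn eqxx leqnn e_sym.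
    by have -> : i.+2 = 2 * k - 1 by clear -h1; lia.
  - rewrite h1 ltnn eqxx; have -> : ((2 * k).+1 < 2 * k) = false by clear; lia.
    have -> : ((2 * k).+1 == 2 * k) = false by clear; lia.
    by rewrite e_sym.
have [p pk] := cyc_dominating k3 e_sym og dns sat (x 0) cf.
rewrite modn_small ?addn1 //; case: p pk => [|[|p]] pk /=; rewrite ?(negPf nz) ?(negPf nw) //.
case: ifP => [pk'|_]; last by case: ifP => _; rewrite ?(negPf nz) ?(negPf nw').
move=> x0p; have a1 := adj_odd e_sym og x0p (cyc_seg cx (leq0n p.+2)).
have pk1 : p.+2 <= 2 * k + 1 by clear -pk; lia.
have a2 := adj_odd e_sym og x0p (wlk_sym e_sym (cyc_back cx pk1)).
clear -a1 a2 pk'; lia.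
Qed.

Lemma unseen z : ~~ e (x 0) z -> ~~ sees true z -> ~~ sees false z -> e z (x 1) \/ e z (x (2 * k)).
Proof.
move=> nz nt nf; have [p pk zp] := cyc_dominating k3 e_sym og dns sat z cx.
have [p0|p1] := posnP p; first by rewrite p0 e_sym (negPf nz) in zp.
have [p1'|[pk'|pm]] : p = 1 \/ p = 2 * k \/ 2 <= p < 2 * k by clear -pk p1; lia.
- by left; rewrite -p1'.
- by right; rewrite -pk'.
have [p2 p2k] := andP pm.
have : sees (odd p) z by apply/seesP; exists p.
by case: (odd p); rewrite ?(negPf nt) ?(negPf nf).
Qed.

Lemma unseen_edge z w : e z (x 1) \/ e z (x (2 * k)) -> e w (x 1) \/ e w (x (2 * k)) -> ~~ e z w.
Proof.
have w0 a : e a (x 1) \/ e a (x (2 * k)) -> wlk e 2 a (x 0).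
  case=> h; apply: (wlkS h); rewrite wlk1; first by rewrite e_sym; apply: (proj2 cx).
  by rewrite -(cyc_closed cx) addn1; apply: (proj2 cx).
move=> /w0 wz /w0 ww; apply/negP => zw.
have := adj_odd e_sym og zw (wlk_cat wz (wlk_sym e_sym ww)); clear -k3; lia.
Qed.

(** A vertex seeing the inner part of [x] is coloured by the parity it sees. The others are adjacent
    to x 1 or x (2k), hence independent, and by [sees_far] their coloured neighbours all have one
    colour. *)
Lemma color_off_cycle : exists v (col : V -> bool), forall a b, ~~ e v a -> ~~ e v b -> e a b -> col a != col b.
Proof.
exists (x 0), (fun z => if sees true z || sees false z then sees true z
  else ~~ [exists w, [&& ~~ e (x 0) w, e z w & sees true w]]).
have half a b : ~~ e (x 0) a -> ~~ e (x 0) b -> e a b -> sees true a || sees false a -> ~~ (sees true b || sees false b) ->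
    sees true a = [exists w, [&& ~~ e (x 0) w, e b w & sees true w]].
  move=> na nb ab ca cb; apply/idP/existsP => [ta|[w /and3P[nw bw tw]]].
    by exists a; rewrite na ta e_sym ab.
  have [//|ta] := boolP (sees true a); rewrite (negPf ta) /= in ca.
  have ba : e b a by rewrite e_sym.
  by have /negP[] := sees_far nb na nw ba bw ca.
move=> a b na nb ab; case: ifP => ca; case: ifP => cb.
- have ba : e b a by rewrite e_sym.
  case ta: (sees true a) ca => /= fa; first by rewrite (negPf (sees_edge ab ta)).
  by have := sees_edge ab fa; case/orP: cb => ->.
- by rewrite (half a b) ?cb //; case: [exists _, _].
- by rewrite eq_sym (half b a) ?ca //; [case: [exists _, _] | rewrite e_sym].
have := unseen_edge (unseen na _ _) (unseen nb _ _); rewrite ab.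
move/negbT: ca; move/negbT: cb; rewrite !negb_or => /andP[h1 h2] /andP[h3 h4].
by move=> /(_ h3 h4 h1 h2).
Qed.

End Coloring.

(** * Assembly of the colouring, the saturation and the potential *)

Lemma color_saturated (V : finType) (e : rel V) k : 1 < k -> symmetric e -> no_short_odd e k -> dense e k ->
  saturated e k -> 0 < #|V| ->
  exists v (col : V -> bool), forall a b, ~~ e v a -> ~~ e v b -> e a b -> col a != col b.
Proof.
move=> k2 es og dns sat V0; have [k3|ke] : 2 < k \/ k = 2 by clear -k2; lia.
  have [/(cyc_exists k3 es og sat)[x cx]|no] := classic (exists d x, odd d && wlk e d x x).
    exact: (color_off_cycle k3 es og dns sat cx).
  have [|col cP] := two_color es; last by case/card_gt0P: V0 => v _; exists v, col => a b _ _; apply: cP.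
  by move=> d x od; apply/negP => w; apply: no; exists d, x; rewrite od.
by subst k; apply: color_off_min_degree.
Qed.

Lemma mobius_hom_dense (V : finType) (e : rel V) k : 1 < k -> symmetric e -> no_short_odd e k -> dense e k ->
  exists f : V -> 'I_(4 * k), forall a b, e a b -> mobius_adj (f a) (f b).
Proof.
move=> k2; move: e.
apply: (@saturation_ind V k (fun e => exists f : V -> 'I_(4 * k), forall a b, e a b -> mobius_adj (f a) (f b))).
  by move=> r r' rr' [f fP]; exists f => a b /rr'; apply: fP.
move=> r rs og dns sat; have [V0|/card_gt0P V0] := posnP #|V|.
  have k4 : 0 < 4 * k by clear -k2; lia.
  exists (fun=> Ordinal k4) => a; have := card0_eq V0 a; by rewrite inE.
have [v [col colP]] := color_saturated k2 rs og dns sat (introT card_gt0P V0).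
exact: colored_hom k2 rs og dns colP.
Qed.

Lemma bigminn_le (I : eqType) (s : seq I) (F : I -> nat) m i : i \in s -> \big[minn/m]_(j <- s) F j <= F i.
Proof.
elim: s => //= j s IH; rewrite inE big_cons geq_min => /predU1P[->|/IH ->]; rewrite ?leqnn ?orbT //.
Qed.

Local Open Scope ring_scope.

Theorem theorem1p2 (k n : nat) (hk : (2 <= k)%N) (G : sgraph)
    (hn : #|G| = n) (hgirth : odd_girth_at_least G (2 * k + 1))
    (hdeg : (4 * n)%:R / (6 * k%:R - 1) < (min_degree G)%:R :> rat) :
  homomorphic G (mobius_ladder (4 * k)).
Proof.
apply: (@mobius_hom_dense G (@adj G) k hk (@adj_sym G) (girth_no_short_odd hgirth)) => v.
have dv : (min_degree G <= #|[set w | adj v w]|)%N.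
  exact: bigminn_le (mem_index_enum v).
have k6 : (0 < 6 * k - 1)%N by clear -hk; lia.
have ke : 6 * k%:R - 1 = (6 * k - 1)%N%:R :> rat by rewrite GRing.natrB ?GRing.natrM //; clear -hk; lia.
rewrite ke Num.Theory.ltr_pdivrMr ?Num.Theory.ltr0n // -GRing.natrM Num.Theory.ltr_nat in hdeg.
by rewrite hn [X in (_ < X)%N]mulnC; apply: leq_trans hdeg _; rewrite leq_mul2r dv orbT.
Qed.
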